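(* For a finite group $\Gamma$, the ring $\mathbb C\otimes_\mathbb{Z}\mathcal G_\Gamma(n)$ for every $n$ does not depend on the group $\Gamma$ itself, but (up to isomorphism) only on the two numbers $|\Gamma_*|$ and $|\Gamma_*^{re}|$. That is, if $\Gamma$ and $G$ are finite groups such that $|\Gamma_*|=|G_*|$ and $|\Gamma_*^{re}|=|G_*^{re}|$, then the rings $\mathbb C\otimes_\mathbb{Z}\mathcal G_\Gamma(n)$ and $\mathbb C\otimes_\mathbb{Z}\mathcal G_G(n)$ are isomorphic for every $n\ge1$.
   Context: For a finite group $\Gamma$, $\Gamma_*$ is the set of conjugacy classes of $\Gamma$, $c^0=\{1\}$, $\bar c=\{x\mid x^{-1}\in c\}$, and $\Gamma_*^{re}=\{c\in\Gamma_*\mid c\ne c^0,\ c=\bar c\}$. $S_n$ acts on $\Gamma^n$ by $\sigma(g_1,\dots,g_n)=(g_{\sigma^{-1}(1)},\dots,g_{\sigma^{-1}(n)})$, and $\Gamma_n=\Gamma^n\rtimes S_n$ with $(g,\sigma)(h,\tau)=(g\,\sigma(h),\sigma\tau)$. For $x=(g,\sigma)$ and a cycle $(i_1\cdots i_k)$ of $\sigma$ (fixed points are 1-cycles), the cycle-product is $g_{i_k}\cdots g_{i_1}$, well defined up to conjugacy. $\mathcal P(\Gamma_* )$ is the set of partition-valued functions on $\Gamma_*$; $\|\lambda\|=\sum_c|\lambda(c)|$; $\ell$ is the number of parts of a partition. The type $\rho$ of $x\in\Gamma_n$: the number of parts of $\rho(c)$ equal to $i$ is the number of $i$-cycles of $\sigma$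 with cycle-product in $c$. The modified type $\lambda$: $\lambda(c)=\rho(c)$ for $c\ne c^0$, and $\lambda(c^0)$ is obtained from $\rho(c^0)$ by subtracting 1 from every part (zeros discarded). $K_\lambda(n)\in\mathbb Z[\Gamma_n]$ is the sum of all elements of $\Gamma_n$ of modified type $\lambda$; it is nonzero iff $\|\lambda\|+\ell(\lambda(c^0))\le n$, and the nonzero ones form a $\mathbb Z$-basis of the center $R_\mathbb{Z}(\Gamma_n)$ of $\mathbb Z[\Gamma_n]$. Assigning degree $\|\lambda\|$ to $K_\lambda(n)$ makes $R_\mathbb{Z}(\Gamma_n)$ a filtered ring; $\mathcal G_\Gamma(n)$ is the associated graded ring. *)

(* Defs.v *)
From HB Require Import structures.
From mathcomp Require Import all_boot all_order all_algebra all_fingroup.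
From mathcomp Require Import boolp.

Set Implicit Arguments.
Unset Strict Implicit.
Unset Printing Implicit Defensive.

Import GRing.Theory.

Section GroupRing.
Local Open Scope ring_scope.
Variables (R : nzRingType) (G : finGroupType).

Definition group_ring := {ffun G -> R}.
HB.instance Definition _ := GRing.Zmodule.on group_ring.

Implicit Types f g h : group_ring.

Definition gring_elt (x : G) : group_ring := [ffun y => (y == x)%:R].

Definition gring_mul f g : group_ring :=
  [ffun x => \sum_y f y * g (y^-1 * x)%g].

Fact gring_mulA : associative gring_mul.
Proof.
move=> f g h; apply/ffunP => x; rewrite !ffunE.
under [RHS]eq_bigr do rewrite ffunE mulr_suml.
rewrite exchange_big /=; apply: eq_bigr => y _.
rewrite ffunE mulr_sumr (reindex_inj (mulgI y^-1%g)) /=.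
by apply: eq_bigr => z _; rewrite mulrA invMg invgK -!mulgA mulKVg.
Qed.

Fact gring_mul1g : left_id (gring_elt 1%g) gring_mul.
Proof.
move=> f; apply/ffunP => x; rewrite !ffunE (bigD1 1%g) //= big1 => [|y /negPf y1].
  by rewrite ffunE eqxx mul1r invg1 mul1g addr0.
by rewrite ffunE y1 mul0r.
Qed.

Fact gring_mulg1 : right_id (gring_elt 1%g) gring_mul.
Proof.
move=> f; apply/ffunP => x; rewrite !ffunE (bigD1 x) //= big1 => [|y /negPf yx].
  by rewrite ffunE mulVg eqxx mulr1 addr0.
by rewrite ffunE -(inj_eq (mulgI y)) mulKVg mulg1 eq_sym yx mulr0.
Qed.

Fact gring_mulDl : left_distributive gring_mul +%R.
Proof.
move=> f g h; apply/ffunP => x; rewrite !ffunE -big_split /=.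
by apply: eq_bigr => y _; rewrite ffunE mulrDl.
Qed.

Fact gring_mulDr : right_distributive gring_mul +%R.
Proof.
move=> f g h; apply/ffunP => x; rewrite !ffunE -big_split /=.
by apply: eq_bigr => y _; rewrite ffunE mulrDr.
Qed.

Fact gring_one_neq0 : gring_elt 1%g != 0.
Proof.
by apply/eqP => /ffunP/(_ 1%g); rewrite !ffunE eqxx => /eqP; rewrite oner_eq0.
Qed.

HB.instance Definition _ := GRing.Zmodule_isNzRing.Build group_ring
  gring_mulA gring_mul1g gring_mulg1 gring_mulDl gring_mulDr gring_one_neq0.

Lemma group_ringM f g x : (f * g) x = \sum_y f y * g (y^-1 * x)%g.
Proof. by rewrite ffunE. Qed.

End GroupRing.

Section Center.
Local Open Scope ring_scope.
Variable A : nzRingType.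

Definition central : {pred A} := fun z => `[< forall a, z * a = a * z >].

Fact central_subring : subring_closed central.
Proof.
split=> [|x y /asboolP cx /asboolP cy|x y /asboolP cx /asboolP cy];
  apply/asboolP => a; first by rewrite mul1r mulr1.
- by rewrite mulrBl mulrBr cx cy.
- by rewrite -mulrA cy mulrA cx mulrA.
Qed.

HB.instance Definition _ := GRing.isSubringClosed.Build A central central_subring.

Definition center := {z : A | z \in central}.
HB.instance Definition _ := [isSub of center for @sval _ _].
HB.instance Definition _ := [Choice of center by <:].
HB.instance Definition _ := [SubChoice_isSubNzRing of center by <:].

Fact center_mulC : commutative (@GRing.mul center).
Proof. by move=> x y; apply/val_inj => /=; have /asboolP := valP x; apply. Qed.

HB.instance Definition _ := GRing.PzRing_hasCommutativeMul.Build center center_mulC.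

End Center.

Record filtration (A : comNzRingType) := Filtration {
  fil :> nat -> {pred A};
  fil_zmod : forall k, zmod_closed (fil k);
  fil_mono : forall k, {subset fil k <= fil k.+1};
  fil_one : 1%R \in fil 0;
  fil_mul : forall i j a b, a \in fil i -> b \in fil j -> (a * b)%R \in fil (i + j)
}.

Section AssociatedGraded.
Local Open Scope ring_scope.
Variables (A : comNzRingType) (F : filtration A).

(* The direct sum of the F_k is encoded by the polynomials whose k-th           *)
(* coefficient lies in F_k; its product is then that of {poly A}, and the       *)
(* graded ring is its quotient by the direct sum of the F_(k-1), F_(-1) = 0.    *)
Definition rees : {pred {poly A}} := fun p => `[< forall k, p`_k \in F k >].

Fact rees_subring : subring_closed rees.
Proof.
have D k a b : a \in F k -> b \in F k -> a - b \in F k.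
  by case: (fil_zmod F k) => _; apply.
have Z k : 0 \in F k by case: (fil_zmod F k).
split=> [|p q /asboolP hp /asboolP hq|p q /asboolP hp /asboolP hq];
  apply/asboolP => k.
- by rewrite coef1; case: k => [|k] /=; [exact: fil_one | exact: Z].
- by rewrite coefB D.
- rewrite coefM; elim/big_ind: _ => [|a b ha hb|i _].
  + exact: Z.
  + by rewrite -[b]opprK D // -sub0r D.
  + by have := fil_mul (hp i) (hq (k - i)%N); rewrite subnKC // -ltnS.
Qed.

HB.instance Definition _ := GRing.isSubringClosed.Build {poly A} rees rees_subring.

Definition rees_ring := {p : {poly A} | p \in rees}.
HB.instance Definition _ := [isSub of rees_ring for @sval _ _].
HB.instance Definition _ := [Choice of rees_ring by <:].
HB.instance Definition _ := [SubChoice_isSubComNzRing of rees_ring by <:].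

Definition fil_pred k : {pred A} := if k is j.+1 then F j else pred1 0.

Definition rees_ideal : {pred rees_ring} :=
  fun p => `[< forall k, (val p)`_k \in fil_pred k >].

Fact rees_idealP : idealr_closed rees_ideal.
Proof.
have Z k : 0 \in F k by case: (fil_zmod F k).
have D k a b : a \in F k -> b \in F k -> a + b \in F k.
  by case: (fil_zmod F k) => _ B ha hb; rewrite -[b]opprK B // -sub0r B.
split.
- by apply/asboolP => -[|k] /=; rewrite coef0 ?inE.
- by apply/asboolP => /(_ 0%N) /=; rewrite coef1 inE oner_eq0.
move=> p q r /asboolP hq /asboolP hr; apply/asboolP => k /=.
rewrite coefD coefM; case: k (hr k) => [|k] /= hrk.
  rewrite big_ord1 (eqP (hq 0%N)) (eqP hrk) mulr0 addr0; exact: eqxx.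
apply: (D) (hrk); apply: (big_ind (fun a => a \in F k)) => // [|i _]; first exact: D.
have /asboolP/(_ i) pi := valP p.
case: (ltngtP i k.+1) (ltn_ord i) => [ik _|ki|-> _]; last 2 first.
- by rewrite ltnS leqNgt ki.
- by rewrite subnn (eqP (hq 0%N)) mulr0.
have := hq (k.+1 - i)%N; rewrite subSn //= => /(fil_mul pi).
by rewrite subnKC.
Qed.

HB.instance Definition _ := isIdealr.Build rees_ring rees_ideal rees_idealP.

Definition assoc_graded := {ideal_quot rees_ideal}.
HB.instance Definition _ := GRing.ComNzRing.on assoc_graded.

End AssociatedGraded.

Section Tensor.
Local Open Scope ring_scope.
Variables C A : pzRingType.
Local Open Scope quotient_scope.

Definition biadditive (V : zmodType) (f : C -> A -> V) :=
  (forall c c' a, f (c + c') a = f c a + f c' a) /\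
  (forall c a a', f c (a + a') = f c a + f c a').

Implicit Types s t : seq (C * A).

(* The elements of C (x)_Z A are formal sums of pure tensors, two of which are  *)
(* equal iff no biadditive map separates them, i.e., iff their difference lies  *)
(* in the subgroup generated by the bilinearity relations.                      *)
Definition tensor_eqv : rel (seq (C * A)) := fun s t =>
  `[< forall (V : zmodType) (f : C -> A -> V), biadditive f ->
        \sum_(p <- s) f p.1 p.2 = \sum_(p <- t) f p.1 p.2 >].

Fact tensor_eqv_class : equiv_class_of tensor_eqv.
Proof.
split=> [s|s t|s t u].
- exact/asboolP.
- by apply/asboolP/asboolP => h V f bf; rewrite h.
- by move=> /asboolP h1 /asboolP h2; apply/asboolP => V f bf; rewrite h1 ?h2.
Qed.

Canonical tensor_equiv := EquivRelPack tensor_eqv_class.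
Canonical tensor_encModRel := defaultEncModRel tensor_eqv.

Definition tensor := {eq_quot tensor_eqv}.
HB.instance Definition _ := Choice.on tensor.
HB.instance Definition _ := EqQuotient.on tensor.

Lemma tensor_eqP s t : reflect
  (forall (V : zmodType) (f : C -> A -> V), biadditive f ->
     \sum_(p <- s) f p.1 p.2 = \sum_(p <- t) f p.1 p.2)
  (s == t %[mod tensor]).
Proof. by rewrite piE; apply: asboolP. Qed.

Definition tensor_seq_opp s := [seq (- p.1, p.2) | p <- s].
Definition tensor_seq_mul s t := [seq (p.1 * q.1, p.2 * q.2) | p <- s, q <- t].

Definition tensor_zero : tensor := \pi [::].
Definition tensor_one : tensor := \pi [:: (1, 1)].
Definition tensor_opp := lift_op1 tensor tensor_seq_opp.
Definition tensor_add := lift_op2 tensor (@cat (C * A)).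
Definition tensor_mul := lift_op2 tensor tensor_seq_mul.

Lemma biadd0l (V : zmodType) (f : C -> A -> V) a : biadditive f -> f 0 a = 0.
Proof. by case=> h _; apply: (addrI (f 0 a)); rewrite -h !addr0. Qed.

Lemma biaddNl (V : zmodType) (f : C -> A -> V) c a : biadditive f -> f (- c) a = - f c a.
Proof.
by move=> bf; apply/eqP; rewrite -addr_eq0 -bf.1 addNr (biadd0l _ bf).
Qed.

Lemma sum_tensor_seq_opp (V : zmodType) (f : C -> A -> V) s : biadditive f ->
  \sum_(p <- tensor_seq_opp s) f p.1 p.2 = - \sum_(p <- s) f p.1 p.2.
Proof.
by move=> bf; rewrite big_map -sumrN; apply: eq_bigr => p _; rewrite biaddNl.
Qed.

Lemma sum_tensor_seq_mul (V : zmodType) (f : C -> A -> V) s t :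
  \sum_(p <- tensor_seq_mul s t) f p.1 p.2 =
  \sum_(p <- s) \sum_(q <- t) f (p.1 * q.1) (p.2 * q.2).
Proof. by rewrite big_allpairs_dep. Qed.

Lemma biadditive_mull (V : zmodType) (f : C -> A -> V) t : biadditive f ->
  biadditive (fun c a => \sum_(q <- t) f (c * q.1) (a * q.2)).
Proof.
case=> fl fr; split=> [c c' a|c a a']; rewrite -big_split;
  by apply: eq_bigr => q _; rewrite mulrDl (fl, fr).
Qed.

Lemma biadditive_mulr (V : zmodType) (f : C -> A -> V) s : biadditive f ->
  biadditive (fun c a => \sum_(p <- s) f (p.1 * c) (p.2 * a)).
Proof.
case=> fl fr; split=> [c c' a|c a a']; rewrite -big_split;
  by apply: eq_bigr => q _; rewrite mulrDr (fl, fr).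
Qed.

Lemma sum_repr (V : zmodType) (f : C -> A -> V) s : biadditive f ->
  \sum_(p <- generic_quotient.repr (\pi_tensor s)) f p.1 p.2 = \sum_(p <- s) f p.1 p.2.
Proof. by move=> bf; apply: (tensor_eqP (generic_quotient.repr (\pi_tensor s)) s _) => //; rewrite reprK. Qed.

Lemma pi_tensor_opp : {morph \pi_tensor : s / tensor_seq_opp s >-> tensor_opp s}.
Proof.
move=> s; unlock tensor_opp; apply/eqP/tensor_eqP => V f bf.
by rewrite !sum_tensor_seq_opp // sum_repr.
Qed.

Lemma pi_tensor_add : {morph \pi_tensor : s t / s ++ t >-> tensor_add s t}.
Proof.
move=> s t; unlock tensor_add; apply/eqP/tensor_eqP => V f bf.
by rewrite !big_cat /= !sum_repr.
Qed.

Lemma pi_tensor_mul : {morph \pi_tensor : s t / tensor_seq_mul s t >-> tensor_mul s t}.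
Proof.
move=> s t; unlock tensor_mul; apply/eqP/tensor_eqP => V f bf.
rewrite !sum_tensor_seq_mul (sum_repr s (biadditive_mull _ bf)).
by rewrite exchange_big [RHS]exchange_big (sum_repr t (biadditive_mulr _ bf)).
Qed.

Fact tensor_addA : associative tensor_add.
Proof. by do 3!elim/quotW=> ?; rewrite -!pi_tensor_add catA. Qed.

Fact tensor_addC : commutative tensor_add.
Proof.
do 2!elim/quotW=> ?; rewrite -!pi_tensor_add; apply/eqP/tensor_eqP => V f _.
by rewrite !big_cat /= addrC.
Qed.

Fact tensor_add0 : left_id tensor_zero tensor_add.
Proof. by elim/quotW=> ?; rewrite -pi_tensor_add. Qed.

Fact tensor_addN : left_inverse tensor_zero tensor_opp tensor_add.
Proof.
elim/quotW=> s; rewrite -pi_tensor_opp -pi_tensor_add.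
apply/eqP/tensor_eqP => V f bf.
by rewrite big_cat /= sum_tensor_seq_opp // addNr big_nil.
Qed.

HB.instance Definition _ := GRing.isZmodule.Build tensor
  tensor_addA tensor_addC tensor_add0 tensor_addN.

Fact tensor_mulA : associative tensor_mul.
Proof.
do 3!elim/quotW=> ?; rewrite -!pi_tensor_mul; apply/eqP/tensor_eqP => V f _.
rewrite !sum_tensor_seq_mul big_allpairs_dep; apply: eq_bigr => p _.
by rewrite big_allpairs_dep; apply: eq_bigr => q _; apply: eq_bigr => r _; rewrite !mulrA.
Qed.

Fact tensor_mul1l : left_id tensor_one tensor_mul.
Proof.
elim/quotW=> ?; rewrite -!pi_tensor_mul; apply/eqP/tensor_eqP => V f _.
by rewrite sum_tensor_seq_mul big_seq1; apply: eq_bigr => p _; rewrite !mul1r.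
Qed.

Fact tensor_mul1r : right_id tensor_one tensor_mul.
Proof.
elim/quotW=> ?; rewrite -!pi_tensor_mul; apply/eqP/tensor_eqP => V f _.
by rewrite sum_tensor_seq_mul; apply: eq_bigr => p _; rewrite big_seq1 !mulr1.
Qed.

Fact tensor_mulDl : left_distributive tensor_mul tensor_add.
Proof.
do 3!elim/quotW=> ?; rewrite -!pi_tensor_add -!pi_tensor_mul -!pi_tensor_add.
by apply/eqP/tensor_eqP => V f _; rewrite !(big_cat, sum_tensor_seq_mul).
Qed.

Fact tensor_mulDr : right_distributive tensor_mul tensor_add.
Proof.
do 3!elim/quotW=> ?; rewrite -!pi_tensor_add -!pi_tensor_mul -!pi_tensor_add.
apply/eqP/tensor_eqP => V f _; rewrite big_cat !sum_tensor_seq_mul /= -big_split.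
by apply: eq_bigr => p _; rewrite big_cat.
Qed.

HB.instance Definition _ := GRing.Zmodule_isPzRing.Build tensor
  tensor_mulA tensor_mul1l tensor_mul1r tensor_mulDl tensor_mulDr.

End Tensor.

Section ConjugacyClasses.
Variable gT : finGroupType.
Local Open Scope group_scope.

Definition conj_class := {c : {set gT} | c \in classes [set: gT]}.

Definition real_class (c : conj_class) := (val c != 1) && ((val c)^-1 == val c).

Definition class_of (g : gT) : conj_class :=
  Sub (g ^: [set: gT]) (mem_classes (in_setT g)).

Lemma class_ofP g (c : conj_class) : (g \in val c) = (class_of g == c).
Proof.
rewrite -val_eqE /=; have /imsetP[h _ ->] := valP c.
by apply/class_eqP/eqP.
Qed.

Lemma class_ofJ g h : class_of (h * g * h^-1) = class_of g.
Proof.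
by apply/eqP; rewrite -class_ofP /= -{1}[h]invgK -mulgA; apply/imsetP; exists h^-1.
Qed.

Lemma class_of_eq g h : class_of g = class_of h -> exists a, h = a * g * a^-1.
Proof.
move/eqP; rewrite -class_ofP => /imsetP[a _ ->]; exists a.
by rewrite conjgE !mulgA mulgV mul1g -mulgA mulgV mulg1.
Qed.

Lemma class_of1 g : (val (class_of g) == 1) = (g == 1).
Proof.
apply/eqP/eqP => [h|->] /=; last exact: class1G.
by apply/set1gP; rewrite -h class_refl.
Qed.

End ConjugacyClasses.

Section IntegerPartitions.

Definition is_intpart (p : seq nat) := sorted geq p && (0 \notin p).
Definition intpart := {p : seq nat | is_intpart p}.
HB.instance Definition _ := [isSub of intpart for @sval _ _].
HB.instance Definition _ := [Choice of intpart by <:].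

Fact intpart_of_proof (s : seq nat) : is_intpart (sort geq [seq k <- s | 0 < k]).
Proof.
by rewrite /is_intpart sort_sorted ?mem_sort ?mem_filter //= => k l; apply: leq_total.
Qed.

Definition intpart_of (s : seq nat) : intpart := Sub _ (intpart_of_proof s).

Lemma count_intpart_of s k : 0 < k ->
  count_mem k (val (intpart_of s)) = count_mem k s.
Proof.
move=> k0; rewrite /= (seq.permP (permEl (perm_sort _ _))) count_filter.
by apply: eq_count => l /=; case: eqP => // ->.
Qed.

Lemma sumn_intpart_of s : sumn (val (intpart_of s)) = sumn s.
Proof.
rewrite /= (perm_sumn (permEl (perm_sort _ _))).
by elim: s => //= -[|k] s IH //=; rewrite IH.
Qed.

Lemma size_intpart_of s : 0 \notin s -> size (val (intpart_of s)) = size s.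
Proof.
move=> s0; rewrite /= size_sort; congr size; apply/all_filterP.
by apply/allP => k ks; rewrite lt0n; apply: contraNneq s0 => <-.
Qed.

End IntegerPartitions.

Section Wreath.
Variables (gT : finGroupType) (n : nat).
Local Open Scope group_scope.

Definition wreath := ({ffun 'I_n -> gT} * 'S_n)%type.
HB.instance Definition _ := Finite.on wreath.

Implicit Types x y z : wreath.

(* (g, s) (h, t) = (g s(h), s t) where s(h) i = h (s^-1 i) and s t is the       *)
(* composite of functions s \o t, i.e., the product t * s of 'S_n.              *)
Definition wr_mul x y : wreath :=
  ([ffun i => x.1 i * y.1 (x.2^-1 i)], y.2 * x.2).
Definition wr_one : wreath := ([ffun => 1], 1).
Definition wr_inv x : wreath := ([ffun i => (x.1 (x.2 i))^-1], x.2^-1).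

Fact wr_mulA : associative wr_mul.
Proof.
move=> x y z; congr pair; last by rewrite /= mulgA.
by apply/ffunP => i; rewrite !ffunE /= mulgA invMg permM.
Qed.

Fact wr_mul1g : left_id wr_one wr_mul.
Proof.
case=> g s; congr pair; last by rewrite /= mulg1.
by apply/ffunP => i; rewrite !ffunE /= mul1g invg1 perm1.
Qed.

Fact wr_mulVg : left_inverse wr_one wr_inv wr_mul.
Proof.
case=> g s; congr pair; last by rewrite /= mulgV.
by apply/ffunP => i; rewrite !ffunE /= invgK mulVg.
Qed.

HB.instance Definition _ := Finite_isGroup.Build wreath wr_mulA wr_mul1g wr_mulVg.

(* The product g_(i_k) ... g_(i_1) for the cycle i_1 = i, i_(j+1) = x.2 i_j.    *)
Definition cycle_product x (i : 'I_n) : gT :=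
  \prod_(j <- rev (traject x.2 i #|porbit x.2 i|)) x.1 j.

Definition part_fun := {ffun conj_class gT -> intpart}.

Definition pf_norm (lam : part_fun) : nat := \sum_c sumn (val (lam c)).

Definition cycles_in x (c : conj_class gT) : {set {set 'I_n}} :=
  [set C in porbits x.2 | [exists i in C, cycle_product x i \in val c]].

Definition wr_type x : part_fun :=
  [ffun c => intpart_of [seq #|pred_of_set C| | C <- enum (cycles_in x c)]].

Definition modified_type x : part_fun := [ffun c =>
  if val c == 1 then intpart_of [seq k.-1 | k <- val (wr_type x c)]
  else wr_type x c].

Definition class_sum (lam : part_fun) : group_ring int wreath :=
  (\sum_(x | modified_type x == lam) gring_elt int x)%R.

(* The type int * part_fun lists the terms of a finite linear combination; the  *)
(* class_sum n lam of the types lam that do not occur in wreath gT n are 0.     *)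
Definition center_fil (k : nat) : {pred center (group_ring int wreath)} := fun w =>
  `[< exists s : seq (int * part_fun), all (fun p => pf_norm p.2 <= k) s /\
        val w = (\sum_(p <- s) class_sum p.2 *~ p.1)%R >].

(* cyc_loops *)

Lemma wrM1 x y i : (x * y).1 i = x.1 i * y.1 (x.2^-1 i).
Proof. by rewrite ffunE. Qed.

Lemma wrM2 x y : (x * y).2 = y.2 * x.2.
Proof. by []. Qed.

Lemma wrX2 x k : (x ^+ k).2 = x.2 ^+ k.
Proof. by elim: k => // k IH; rewrite expgS wrM2 IH -expgSr. Qed.

Lemma wrXS1 x k i : (x ^+ k.+1).1 (x.2 i) = x.1 (x.2 i) * (x ^+ k).1 i.
Proof. by rewrite expgS wrM1 permK. Qed.

Definition cyc_loop x i := (x ^+ #|porbit x.2 i|).1 i.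

Lemma card_porbit_perm (s : 'S_n) i : #|porbit s (s i)| = #|porbit s i|.
Proof. by rewrite -[s i]/((s ^+ 1) i) porbit_perm. Qed.

Lemma permX_porbit (s : 'S_n) i : (s ^+ #|porbit s i|) i = i.
Proof. by rewrite permX iter_porbit. Qed.

Lemma cycle_product_loop x i : cycle_product x (x.2 i) = cyc_loop x i.
Proof.
rewrite /cycle_product /cyc_loop card_porbit_perm.
suff H k : (x ^+ k).1 ((x.2 ^+ k) i) =
    \prod_(j <- rev (traject x.2 (x.2 i) k)) x.1 j.
  by rewrite -H permX_porbit.
elim: k => [|k IH]; first by rewrite big_nil perm1 ffunE.
rewrite (expgSr x.2) permM wrXS1 IH trajectSr rev_rcons big_cons.
by rewrite -iterSr iterS -permX.
Qed.

Lemma cyc_loop_perm x i : cyc_loop x (x.2 i) = x.1 (x.2 i) * cyc_loop x i * (x.1 (x.2 i))^-1.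
Proof.
rewrite /cyc_loop card_porbit_perm; set k := #|_|.
apply: (mulIg (x.1 (x.2 i))); rewrite mulgKV -wrXS1 (expgSr x) wrM1; congr (_ * x.1 _).
apply: (perm_inj (s := x.2 ^+ k)); rewrite wrX2 permKV /k -card_porbit_perm.
exact: permX_porbit.
Qed.

Lemma cyc_loop_class x i : class_of (cyc_loop x (x.2 i)) = class_of (cyc_loop x i).
Proof. by rewrite cyc_loop_perm class_ofJ. Qed.

Lemma cyc_loop_class_porbit x i j : j \in porbit x.2 i ->
  class_of (cyc_loop x j) = class_of (cyc_loop x i).
Proof.
case/porbitP => k ->; elim: k => [|k IH]; first by rewrite perm1.
by rewrite expgSr permM cyc_loop_class.
Qed.

Lemma cycle_class x i (c : conj_class gT) :
  [exists j in porbit x.2 i, cycle_product x j \in val c]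
  = (class_of (cyc_loop x i) == c).
Proof.
apply/existsP/idP => [[j /andP[ji]]|cE].
  rewrite -{1}[j](permKV x.2) cycle_product_loop class_ofP.
  rewrite (@cyc_loop_class_porbit x i) //.
  by rewrite -eq_porbit_mem -(porbit_perm _ 1) expg1 permKV eq_porbit_mem.
exists (x.2 i); rewrite cycle_product_loop class_ofP cE andbT.
by rewrite -[x.2 i]/((x.2 ^+ 1) i) mem_porbit.
Qed.

End Wreath.

Arguments class_sum {gT} n lam.
Arguments center_fil gT n k _ : clear implicits.

Lemma card_matching (T : finType) (L : eqType) (A B : {set T}) (f g : T -> L) :
  (forall a, a \in A -> #|[set b in A | f b == f a]| = #|[set b in B | g b == f a]|) ->
  exists phi : T -> T, {in A &, injective phi} /\
    forall a, a \in A -> phi a \in B /\ g (phi a) = f a.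
Proof.
move=> cardAB; pose Af a := [set b in A | f b == f a].
pose Bf a := [set b in B | g b == f a].
pose phi a := nth a (enum (Bf a)) (index a (enum (Af a))).
have mAf a : a \in A -> a \in Af a by move=> aA; rewrite inE aA eqxx.
have phiB a : a \in A -> phi a \in Bf a.
  move=> aA; rewrite -mem_enum mem_nth // -cardE -(cardAB a aA) cardE index_mem.
  by rewrite mem_enum mAf.
exists phi; split=> [a b aA bA|a aA]; last first.
  by have := phiB a aA; rewrite inE => /andP[-> /eqP].
move=> e; have fab : f a = f b.
  by have := phiB a aA; have := phiB b bA; rewrite -e !inE => /andP[_ /eqP <-] /andP[_ /eqP].
have EA : Af a = Af b by rewrite /Af fab.
have EB : Bf a = Bf b by rewrite /Bf fab.
move: e; rewrite /phi EA EB (set_nth_default b) => [/eqP|]; last first.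
  by rewrite -EB -cardE -(cardAB a aA) cardE -EA index_mem mem_enum mAf.
have H c : c \in A -> Af c = Af b -> index c (enum (Af b)) < size (enum (Bf b)).
  by move=> cA Ec; rewrite -cardE -(cardAB b bA) cardE index_mem mem_enum -Ec mAf.
rewrite nth_uniq ?enum_uniq ?H // => /eqP ei.
by rewrite -(nth_index b (_ : a \in enum (Af b))) ?ei ?nth_index // mem_enum ?mAf // -EA mAf.
Qed.

Section Degree.
Variables (gT : finGroupType) (n : nat).
Local Open Scope group_scope.
Implicit Types (x y z : wreath gT n) (c : conj_class gT).

Definition cyc_class x (C : {set 'I_n}) :=
  if [pick i in C] is Some i then class_of (cyc_loop x i) else class_of 1.

Lemma cyc_classE x i : cyc_class x (porbit x.2 i) = class_of (cyc_loop x i).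
Proof.
rewrite /cyc_class; case: pickP => [j|/(_ i)]; first exact: cyc_loop_class_porbit.
by rewrite /= porbit_id.
Qed.

Lemma cycles_inE x c C :
  (C \in cycles_in x c) = (C \in porbits x.2) && (cyc_class x C == c).
Proof.
rewrite inE; case: imsetP => //= -[i _ ->].
by rewrite cycle_class cyc_classE.
Qed.

Lemma count_wr_type x c k : 0 < k -> count_mem k (val (wr_type x c)) =
  #|[set C in porbits x.2 | (cyc_class x C, #|C|) == (c, k)]|.
Proof.
move=> k0; rewrite ffunE count_intpart_of // count_map -sum1_count big_enum_cond /=.
rewrite sum1dep_card; apply: eq_card => C.
by rewrite [LHS]inE cycles_inE !inE xpair_eqE andbA.
Qed.

Lemma sumn_wr_type x c : sumn (val (wr_type x c)) = \sum_(C in cycles_in x c) #|C|.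
Proof. by rewrite ffunE sumn_intpart_of sumnE big_map big_enum. Qed.

Lemma cycle_gt0 x c C : C \in cycles_in x c -> 0 < #|C|.
Proof.
rewrite cycles_inE => /andP[/imsetP[i _ ->] _]; rewrite lt0n; exact: card_porbit_neq0.
Qed.

Lemma size_wr_type x c : size (val (wr_type x c)) = #|cycles_in x c|.
Proof.
rewrite ffunE size_intpart_of ?size_map -?cardE //.
by apply/mapP => -[C]; rewrite mem_enum => /cycle_gt0; case: #|_|.
Qed.

Lemma sum_wr_type x : \sum_c sumn (val (wr_type x c)) = n.
Proof.
under eq_bigr => c _ do (rewrite sumn_wr_type;
  under eq_bigl do rewrite cycles_inE).
rewrite -(partition_big (cyc_class x) predT) //.
rewrite -[RHS]card_ord -sum1_card.
rewrite [RHS](partition_big (porbit x.2) (mem (porbits x.2))) /=; last first.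
  by move=> i _; apply: imset_f.
apply: eq_bigr => C /imsetP[i _ ->]; rewrite sum1dep_card; apply: eq_card => j.
by rewrite inE eq_porbit_mem porbit_sym.
Qed.

Lemma sumn_pred (s : seq nat) : 0 \notin s ->
  sumn [seq k.-1 | k <- s] + size s = sumn s.
Proof.
elim: s => //= -[|k] s IH; rewrite inE //= => /IH <-.
by rewrite addnS -addnA addSn.
Qed.

Lemma wr_type0 x c : 0 \notin val (wr_type x c).
Proof. by have /andP[] := valP (wr_type x c). Qed.

Let c1 : conj_class gT := class_of 1.

Lemma val_c1 c : (val c == 1) = (c == c1).
Proof. by rewrite -[RHS]val_eqE /= class1G. Qed.

Definition wr_deg x := pf_norm (modified_type x).

Lemma wr_deg_triv x : wr_deg x + #|cycles_in x c1| = n.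
Proof.
rewrite -[RHS](sum_wr_type x) /wr_deg /pf_norm (bigD1 c1) //= [RHS](bigD1 c1) //=.
rewrite addnAC; congr (_ + _).
  rewrite ffunE val_c1 eqxx sumn_intpart_of -size_wr_type sumn_pred //.
  exact: wr_type0.
by apply: eq_bigr => c /negPf cc1; rewrite ffunE val_c1 cc1.
Qed.

Lemma modified_type_count x y : modified_type x = modified_type y ->
  forall c k, 0 < k -> count_mem k (val (wr_type x c)) = count_mem k (val (wr_type y c)).
Proof.
move=> exy c k k0; have /ffunP/(_ c) := exy.
rewrite [LHS]ffunE [RHS]ffunE val_c1; case: eqP => [->|_ ->] //.
set p := val (wr_type x c1); set q := val (wr_type y c1) => epq.
have sz : size p = size q.
  have dxy : wr_deg x = wr_deg y by rewrite /wr_deg exy.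
  apply/eqP; rewrite /p /q !size_wr_type -(eqn_add2l (wr_deg x)) [in X in _ == X]dxy.
  by rewrite !wr_deg_triv.
have cnt j (s : seq nat) : 0 \notin s ->
    count_mem j.+2 s = count_mem j.+1 (val (intpart_of [seq k.-1 | k <- s])).
  move=> s0; rewrite count_intpart_of // count_map; apply: eq_in_count => -[|i] //=.
have cnt1 (s : seq nat) : 0 \notin s ->
    count_mem 1%N s + size (val (intpart_of [seq k.-1 | k <- s])) = size s.
  move=> s0; rewrite /= size_sort size_filter count_map -(count_predC (pred1 1%N)).
  congr (_ + _); apply: eq_in_count => -[|[|i]] //= i0.
  by rewrite i0 in s0.
case: k k0 => [|[|k]] // _; last by rewrite !cnt ?wr_type0 // epq.
apply/eqP; rewrite -(eqn_add2r (size (val (intpart_of [seq k.-1 | k <- p])))).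
by rewrite cnt1 ?wr_type0 // epq cnt1 ?wr_type0 // sz.
Qed.

End Degree.

Section Rep.
Variables (n : nat) (s : 'S_n).
Local Open Scope group_scope.
Implicit Types i j : 'I_n.

Definition cyc_rep i := odflt i [pick j in porbit s i].

Lemma cyc_rep_porbit i : cyc_rep i \in porbit s i.
Proof. by rewrite /cyc_rep; case: pickP => //= _; apply: porbit_id. Qed.

Lemma porbit_cyc_rep i : porbit s (cyc_rep i) = porbit s i.
Proof. by apply/eqP; rewrite eq_porbit_mem cyc_rep_porbit. Qed.

Lemma eq_cyc_rep i j : porbit s i = porbit s j -> cyc_rep i = cyc_rep j.
Proof. by rewrite /cyc_rep => ->; case: pickP => //= /(_ j); rewrite porbit_id. Qed.

Lemma cyc_rep_perm i : cyc_rep (s i) = cyc_rep i.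
Proof. by apply: eq_cyc_rep; exact: (porbit_perm s 1). Qed.

Lemma cyc_rep_id i : cyc_rep (cyc_rep i) = cyc_rep i.
Proof. by apply: eq_cyc_rep; rewrite porbit_cyc_rep. Qed.

Definition cyc_idx i := index i (traject s (cyc_rep i) #|porbit s i|).

Lemma cyc_idx_mem i : i \in traject s (cyc_rep i) #|porbit s i|.
Proof. by rewrite -porbit_cyc_rep -porbit_traject porbit_cyc_rep porbit_id. Qed.

Lemma cyc_idx_lt i : cyc_idx i < #|porbit s i|.
Proof. by have := cyc_idx_mem i; rewrite -index_mem size_traject. Qed.

Lemma cyc_idxK i : (s ^+ cyc_idx i) (cyc_rep i) = i.
Proof. by rewrite permX -[RHS](nth_index (cyc_rep i) (cyc_idx_mem i)) nth_traject // cyc_idx_lt. Qed.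

Lemma permX_inj_lt i (j k : nat) : j < #|porbit s i| -> k < #|porbit s i| ->
  (s ^+ j) i = (s ^+ k) i -> j = k.
Proof.
move=> jl kl; rewrite !permX -(nth_traject s jl i) -(nth_traject s kl i) => /eqP.
by rewrite nth_uniq ?size_traject ?uniq_traject_porbit // => /eqP.
Qed.

End Rep.

Section Conjugacy.
Variables (gT : finGroupType) (n : nat).
Local Open Scope group_scope.
Implicit Types (x y z : wreath gT n) (i j : 'I_n).

Definition cyc_lab x m i := (x ^+ m).1 ((x.2 ^+ m) i).

Lemma cyc_lab1 x i : cyc_lab x 1 i = x.1 (x.2 i).
Proof. by []. Qed.

Lemma cyc_labD x m k i : cyc_lab x (m + k) i = cyc_lab x m ((x.2 ^+ k) i) * cyc_lab x k i.
Proof.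
have e : (x.2 ^+ (m + k)) i = (x.2 ^+ m) ((x.2 ^+ k) i).
  by rewrite addnC expgD permM.
by rewrite /cyc_lab expgD wrM1 e wrX2 permK.
Qed.

Lemma cyc_lab_loop x i : cyc_lab x #|porbit x.2 i| i = cyc_loop x i.
Proof. by rewrite /cyc_lab permX_porbit. Qed.

Lemma wr_ext x y : x.1 =1 y.1 -> x.2 = y.2 -> x = y.
Proof. by case: x y => [x1 x2] [y1 y2] /= /ffunP-> ->. Qed.

Lemma wr_conj x y : modified_type x = modified_type y ->
  exists z, y = z * x * z^-1.
Proof.
move=> /modified_type_count cnt.
have pm (s : 'S_n) i : porbit s i \in porbits s by apply: imset_f.
have card_gt0 (s : 'S_n) C : C \in porbits s -> 0 < #|C|.
  by case/imsetP => i _ ->; rewrite lt0n card_porbit_neq0.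
have [phi [phi_inj phiP]] := @card_matching _ _ (porbits x.2) (porbits y.2)
    (fun C => (cyc_class x C, #|C|)) (fun C => (cyc_class y C, #|C|))
    (fun C CP => etrans (esym (count_wr_type x _ (card_gt0 _ C CP)))
       (etrans (cnt _ _ (card_gt0 _ C CP)) (count_wr_type y _ (card_gt0 _ C CP)))).
have /fin_all_exists[w wP] i : exists w : 'I_n * gT,
    phi (porbit x.2 i) = porbit y.2 w.1 /\
    [/\ #|porbit y.2 w.1| = #|porbit x.2 i| & cyc_loop y w.1 = w.2 * cyc_loop x i * w.2^-1].
  have [/imsetP[j _ Ej]] := phiP _ (pm x.2 i).
  rewrite Ej !cyc_classE => E; have Ec := congr1 snd E.
  by have [a Ea] := class_of_eq (esym (congr1 fst E)); exists (j, a).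
pose V m r := ((y.2 ^+ m) (w r).1, cyc_lab y m (w r).1 * (w r).2 * (cyc_lab x m r)^-1).
have VP m r : V (m + #|porbit x.2 r|) r = V m r.
  have [_ [wc wl]] := wP r; rewrite /V !cyc_labD cyc_lab_loop permX_porbit -wc cyc_lab_loop.
  rewrite addnC expgD permM permX_porbit; congr pair.
  by rewrite wl invMg !mulgA mulgKV mulgK.
have VM q m r : V (q * #|porbit x.2 r| + m) r = V m r.
  by elim: q => // q IH; rewrite mulSn -addnA addnC VP.
pose W i := V (cyc_idx x.2 i) (cyc_rep x.2 i).
have WE m i : (x.2 ^+ m) (cyc_rep x.2 i) = i -> W i = V m (cyc_rep x.2 i).
  move=> Ei; rewrite (divn_eq m #|porbit x.2 (cyc_rep x.2 i)|) VM; congr V.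
  have rl : m %% #|porbit x.2 (cyc_rep x.2 i)| < #|porbit x.2 (cyc_rep x.2 i)|.
    by rewrite ltn_mod lt0n card_porbit_neq0.
  apply: permX_inj_lt rl _; first by rewrite porbit_cyc_rep cyc_idx_lt.
  rewrite cyc_idxK -{1}Ei {1}(divn_eq m #|porbit x.2 (cyc_rep x.2 i)|) expgD permM.
  congr (fun_of_perm _ _); elim: (_ %/ _) => [|q IH]; first by rewrite perm1.
  by rewrite mulSn expgD permM permX_porbit.
have WS i : W (x.2 i) = (y.2 (W i).1, y.1 (y.2 (W i).1) * (W i).2 * (x.1 (x.2 i))^-1).
  rewrite (WE (1 + cyc_idx x.2 i)%N); last by rewrite addnC expgD permM cyc_rep_perm cyc_idxK.
  rewrite /W cyc_rep_perm /V !cyc_labD /= cyc_idxK !cyc_lab1 invMg !mulgA; congr pair.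
  by rewrite addnC expgD permM.
have W_inj : injective (fun i => (W i).1).
  move=> i j /= eW; have [wi [ci _]] := wP (cyc_rep x.2 i); have [wj _] := wP (cyc_rep x.2 j).
  have er : cyc_rep x.2 i = cyc_rep x.2 j.
    apply: eq_cyc_rep; apply: phi_inj; rewrite ?pm //.
    rewrite -(porbit_cyc_rep x.2 i) -(porbit_cyc_rep x.2 j) wi wj.
    by rewrite -(porbit_perm _ (cyc_idx x.2 i)) eW porbit_perm.
  move: eW; rewrite /W er /= => eW.
  rewrite -(cyc_idxK x.2 i) -(cyc_idxK x.2 j) er (permX_inj_lt _ _ eW) // -er ci.
    by rewrite porbit_cyc_rep cyc_idx_lt.
  by rewrite er porbit_cyc_rep cyc_idx_lt.
pose p := perm W_inj.
have pE i : p i = (W i).1 by rewrite permE.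
pose z : wreath gT n := ([ffun j => (W (p^-1 j)).2], p).
have z1 j : z.1 j = (W (p^-1 j)).2 by rewrite ffunE.
have z2 : z.2 = p by [].
clearbody W z; exists z; apply: (mulIg z); rewrite mulgKV; apply: wr_ext.
  move=> k; have [i ->] : exists i, k = p (x.2 i).
    by exists (x.2^-1 (p^-1 k)); rewrite !permKV.
  by rewrite !wrM1 !z1 z2 permK pE WS /= mulgKV permK -pE permK.
by apply/permP => i; rewrite !wrM2 !permM z2 !pE WS.
Qed.

End Conjugacy.

Section GainEquations.
Variables (gT : finGroupType) (n : nat).
Local Open Scope group_scope.

Let Omega := {ffun 'I_n -> option gT}.
Let q := #|gT|.+1.

Definition opt_lmul (g : gT) : option gT -> option gT := omap (fun h => g * h).
Definition opt_rmul (g : gT) : option gT -> option gT := omap (fun h => h * g).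

Implicit Types (f h : Omega) (L : seq ('I_n * 'I_n * gT)) (i j k : 'I_n).

(* Subadditivity of the norm of the modified type (wr_degM). An element acts on *)
(* the functions f : 'I_n -> gT + {0}, and f is fixed iff it solves a system of *)
(* equations f i = g f j. The fixed functions of x number #|gT|.+1 ^ b, with b  *)
(* the number of cycles of x with trivial cycle-product, and b = n - wr_deg x;  *)
(* each added equation divides the number of solutions by at most #|gT|.+1.     *)
Definition gain_sol L : {set Omega} :=
  [set f : Omega | all (fun e => f e.1.1 == opt_lmul e.2 (f e.1.2)) L].

Lemma gain_solP L f : reflect (forall i j g, (i, j, g) \in L -> f i = opt_lmul g (f j))
  (f \in gain_sol L).
Proof.
rewrite inE; apply: (iffP allP) => [H i j g /H /eqP //|H [[i j] g] /H /= ->]; exact: eqxx.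
Qed.

Lemma opt_lmulK g : cancel (opt_lmul g) (opt_lmul g^-1).
Proof. by case=> //= h; rewrite mulKg. Qed.

Lemma opt_lmulM g g' o : opt_lmul (g * g') o = opt_lmul g (opt_lmul g' o).
Proof. by case: o => //= h; rewrite mulgA. Qed.

Lemma opt_lmul1 o : opt_lmul 1 o = o.
Proof. by case: o => //= h; rewrite mul1g. Qed.

Lemma opt_lmul_rmul g g' o : opt_lmul g (opt_rmul g' o) = opt_rmul g' (opt_lmul g o).
Proof. by case: o => //= h; rewrite mulgA. Qed.

Definition gain_comp L i : {set 'I_n} := [set k |
  [forall f in gain_sol L, forall h in gain_sol L, (f i == h i) ==> (f k == h k)]].

Lemma gain_compP L i k : reflect
  (forall f h, f \in gain_sol L -> h \in gain_sol L -> f i = h i -> f k = h k)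
  (k \in gain_comp L i).
Proof.
rewrite inE; apply: (iffP 'forall_in_forall_inP) => [H f h fL hL e|H f fL h hL].
  by apply/eqP; apply: implyP (H f fL h hL) _; apply/eqP.
by apply/implyP => /eqP e; apply/eqP; apply: H.
Qed.

Lemma gain_comp_id L i : i \in gain_comp L i.
Proof. exact/gain_compP. Qed.

Lemma gain_comp_edge L i j k g : (j, k, g) \in L -> (j \in gain_comp L i) = (k \in gain_comp L i).
Proof.
move=> e; apply/gain_compP/gain_compP => H f h fL hL /(H f h fL hL);
  rewrite ((gain_solP _ _ fL) _ _ _ e) ((gain_solP _ _ hL) _ _ _ e).
  exact: (can_inj (opt_lmulK g)).
by move=> ->.
Qed.

Definition gain_splice L i f h : Omega := [ffun k => if k \in gain_comp L i then h k else f k].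

Lemma gain_splice_sol L i f h : f \in gain_sol L -> h \in gain_sol L ->
  gain_splice L i f h \in gain_sol L.
Proof.
move=> fL hL; apply/gain_solP => j k g e; rewrite !ffunE (gain_comp_edge i e).
by case: ifP => _; apply: (gain_solP _ _ _) e.
Qed.

Lemma none_sol L : [ffun=> None] \in gain_sol L.
Proof. by apply/gain_solP => j k g _; rewrite !ffunE. Qed.

Lemma rmul_sol L f g : f \in gain_sol L -> [ffun k => opt_rmul g (f k)] \in gain_sol L.
Proof.
move=> /gain_solP H; apply/gain_solP => j k g' e; rewrite !ffunE.
by rewrite opt_lmul_rmul -(H _ _ _ e).
Qed.

Lemma card_splice L L' i (Phi : Omega -> Omega) :
    (forall f, f \in gain_sol L -> gain_splice L i f (Phi f) \in gain_sol L') ->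
  #|gain_sol L| <= #|gain_sol L'| * q.
Proof.
move=> H; pose F f := (gain_splice L i f (Phi f), f i).
have F_inj : {in gain_sol L &, injective F}.
  move=> f h fL hL [e /= ei]; apply/ffunP => k.
  case kC: (k \in gain_comp L i); first exact: (gain_compP _ _ _ kC).
  by have /ffunP/(_ k) := e; rewrite !ffunE kC.
have -> : q = #|[set: option gT]| by rewrite cardsT card_option.
rewrite -(card_in_imset F_inj) -cardsX subset_leq_card //.
by apply/subsetP => _ /imsetP[f fL ->]; rewrite in_setX in_setT andbT H.
Qed.

Lemma card_gain_cons L e : #|gain_sol L| <= #|gain_sol (e :: L)| * q.
Proof.
case: e => [[i j] g].
have solE f : (f \in gain_sol ((i, j, g) :: L)) =
    (f i == opt_lmul g (f j)) && (f \in gain_sol L) by rewrite !inE.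
have nL := none_sol L.
case jC: (j \in gain_comp L i).
  apply: (@card_splice _ _ i (fun=> [ffun=> None])) => f fL.
  by rewrite solE gain_splice_sol // !ffunE jC gain_comp_id.
case: (pickP [pred u in gain_sol L | u i != None]) => [u /andP[/= uL]|no_u].
  case ui: (u i) => [a|] // _.
  apply: (@card_splice _ _ i (fun f => if f j is Some b
    then [ffun k => opt_rmul (a^-1 * (g * b)) (u k)] else [ffun=> None])) => f fL.
  rewrite solE gain_splice_sol ?andbT //; last by case: (f j) => // b; exact: rmul_sol.
  rewrite !ffunE gain_comp_id jC; case: (f j) => [b|]; rewrite ?ffunE ?ui //=.
  by rewrite mulKVg.
apply: (@card_splice _ _ j (fun=> [ffun=> None])) => f fL.
rewrite solE gain_splice_sol // !ffunE gain_comp_id andbT.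
by case: ifP => _; [| have := no_u f; rewrite inE fL /= => /negbFE].
Qed.

Lemma card_gain_cat L L' : #|gain_sol L| <= #|gain_sol (L' ++ L)| * q ^ size L'.
Proof.
elim: L' => [|e L' IH]; first by rewrite muln1.
rewrite expnS mulnA (leq_trans IH) // leq_mul2r; apply/orP; right.
exact: card_gain_cons.
Qed.

Definition fix_sol (x : wreath gT n) : {set Omega} :=
  [set f : Omega | [forall i, f (x.2 i) == opt_lmul (x.1 (x.2 i)) (f i)]].

Lemma fix_solP (x : wreath gT n) f :
  reflect (forall i, f (x.2 i) = opt_lmul (x.1 (x.2 i)) (f i)) (f \in fix_sol x).
Proof. by rewrite inE; apply: (iffP forallP) => H i; apply/eqP. Qed.

Lemma fix_solM (x y : wreath gT n) f : f \in fix_sol x -> f \in fix_sol y -> f \in fix_sol (x * y).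
Proof.
move=> /fix_solP fx /fix_solP fy; apply/fix_solP => i.
by rewrite wrM2 permM fx fy wrM1 permK opt_lmulM.
Qed.

Lemma fix_sol_cyc_lab (x : wreath gT n) f m i : f \in fix_sol x ->
  f ((x.2 ^+ m) i) = opt_lmul (cyc_lab x m i) (f i).
Proof.
move=> /fix_solP fx; elim: m => [|m IH]; first by rewrite perm1 /cyc_lab ffunE opt_lmul1.
by rewrite expgSr permM fx IH -opt_lmulM -cyc_lab1 -cyc_labD.
Qed.

Definition base_points (x : wreath gT n) : {set 'I_n} :=
  [set i | (cyc_rep x.2 i == i) && (cyc_loop x i == 1)].

Lemma cyc_loop1_porbit (x : wreath gT n) i j : porbit x.2 i = porbit x.2 j ->
  (cyc_loop x i == 1) = (cyc_loop x j == 1).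
Proof.
move/eqP; rewrite eq_porbit_mem => /cyc_loop_class_porbit e.
by rewrite -!class_of1 e.
Qed.

Lemma card_fix_sol (x : wreath gT n) : #|fix_sol x| <= q ^ #|base_points x|.
Proof.
pose F f : Omega := [ffun i => if i \in base_points x then f i else None].
have F_inj : {in fix_sol x &, injective F}.
  move=> f h fx hx /ffunP e; apply/ffunP => i.
  have main f' : f' \in fix_sol x -> cyc_loop x i == 1 -> f' i = opt_lmul (cyc_lab x (cyc_idx x.2 i) (cyc_rep x.2 i)) (F f' (cyc_rep x.2 i)).
    move=> fx' l1; rewrite ffunE inE cyc_rep_id eqxx (cyc_loop1_porbit (porbit_cyc_rep _ _)) l1 /=.
    by rewrite -fix_sol_cyc_lab // cyc_idxK.
  case l1: (cyc_loop x i == 1); first by rewrite !main // e.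
  have none f' : f' \in fix_sol x -> f' i = None.
    move=> fx'; have := fix_sol_cyc_lab #|porbit x.2 i| i fx'; rewrite permX_porbit cyc_lab_loop.
    case: (f' i) => //= a [] /eqP; rewrite -{1}[a]mul1g (inj_eq (mulIg a)).
    by rewrite eq_sym l1.
  by rewrite !none.
rewrite -(card_in_imset F_inj).
have <- : #|pffun_on (None : option gT) (base_points x) predT| = (q ^ #|base_points x|)%N.
  by rewrite card_pffun_on card_option.
apply: subset_leq_card; apply/subsetP => _ /imsetP[f _ ->].
apply/pffun_onP; split=> //; apply/subsetP => i.
by rewrite supportE !ffunE; case: ifP.
Qed.

Lemma card_base_points (x : wreath gT n) : #|base_points x| = #|cycles_in x (class_of 1)|.
Proof.
have inj : {in base_points x &, injective (porbit x.2)}.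
  move=> i j; rewrite !inE => /andP[/eqP <- _] /andP[/eqP <- _].
  by rewrite !porbit_cyc_rep => /eq_cyc_rep.
rewrite -(card_in_imset inj); apply: eq_card => C; rewrite cycles_inE.
have eq1 i : (class_of (cyc_loop x i) == class_of 1) = (cyc_loop x i == 1).
  by rewrite -class_of1 -[LHS]val_eqE /= class1G.
apply/imsetP/andP => [[i]|[/imsetP[i _ ->]]].
  by rewrite inE => /andP[_ l1] ->; rewrite cyc_classE eq1 l1 imset_f.
rewrite cyc_classE eq1 => l1; exists (cyc_rep x.2 i); last by rewrite porbit_cyc_rep.
by rewrite inE cyc_rep_id eqxx (cyc_loop1_porbit (porbit_cyc_rep _ _)).
Qed.

Definition gain_eqs (x : wreath gT n) := [seq
  (if cyc_loop x i == 1 then (i, x.2^-1 i, x.1 i) else (i, i, cyc_loop x i))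
  | i <- enum (~: base_points x)].

Lemma size_gain_eqs (x : wreath gT n) : size (gain_eqs x) = wr_deg x.
Proof.
rewrite size_map -cardE cardsCs setCK card_ord card_base_points.
by rewrite -{1}(wr_deg_triv x) addnK.
Qed.

Lemma gain_eqs_fix (x : wreath gT n) f : f \in gain_sol (gain_eqs x) -> f \in fix_sol x.
Proof.
move/gain_solP => H.
have none i : cyc_loop x i != 1 -> f i = None.
  move=> l1; have : (i, i, cyc_loop x i) \in gain_eqs x.
    apply/mapP; exists i; last by rewrite (negPf l1).
    by rewrite mem_enum !inE (negPf l1) andbF.
  move/H; case: (f i) => //= a [] /eqP; rewrite -{1}[a]mul1g (inj_eq (mulIg a)).
  by rewrite eq_sym (negPf l1).
have step i : cyc_loop x i == 1 -> cyc_rep x.2 (x.2 i) != x.2 i ->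
    f (x.2 i) = opt_lmul (x.1 (x.2 i)) (f i).
  move=> l1 ri; apply: H; apply/mapP; exists (x.2 i).
    by rewrite mem_enum !inE (negPf ri).
  by rewrite (cyc_loop1_porbit (porbit_perm _ 1 _)) l1 permK.
apply/fix_solP => i.
have l1P : (cyc_loop x (x.2 i) == 1) = (cyc_loop x i == 1).
  exact: cyc_loop1_porbit (porbit_perm _ 1 _).
case l1: (cyc_loop x i == 1); last by rewrite !none ?l1P ?l1.
have [ri|] := eqVneq (cyc_rep x.2 (x.2 i)) (x.2 i); last exact: step.
set r := x.2 i in ri *; have l1r : cyc_loop x r == 1 by rewrite l1P.
have walk m : m < #|porbit x.2 r| -> f ((x.2 ^+ m) r) = opt_lmul (cyc_lab x m r) (f r).
  elim: m => [|m IH] lt; first by rewrite perm1 /cyc_lab ffunE opt_lmul1.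
  have e1 : (x.2 ^+ m.+1) r = x.2 ((x.2 ^+ m) r) by rewrite expgSr permM.
  rewrite e1 step -?e1.
  - by rewrite e1 IH ?(ltnW lt) // -opt_lmulM -cyc_lab1 -cyc_labD.
  - by rewrite (cyc_loop1_porbit (porbit_perm _ _ _)).
  rewrite (eq_cyc_rep (porbit_perm _ _ _)) ri; apply/eqP => e.
  have := @permX_inj_lt _ x.2 r 0 m.+1; rewrite perm1 => /(_ _ lt e) H0.
  by have := H0 (leq_ltn_trans (leq0n _) lt).
have k0 : 0 < #|porbit x.2 r| by rewrite lt0n card_porbit_neq0.
have iE : i = (x.2 ^+ #|porbit x.2 r|.-1) r.
  by apply: (@perm_inj _ x.2); rewrite -permM -expgSr prednK // permX_porbit.
rewrite {1}iE walk ?prednK // -opt_lmulM.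
suff -> : x.1 r * cyc_lab x #|porbit x.2 r|.-1 r = cyc_loop x r by rewrite (eqP l1r) opt_lmul1.
by rewrite -cyc_lab_loop -[in RHS](prednK k0) -[_.-1.+1]add1n cyc_labD -iE cyc_lab1.
Qed.

Lemma wr_degM (x y : wreath gT n) : wr_deg (x * y) <= wr_deg x + wr_deg y.
Proof.
have q1 : 1 < q by rewrite ltnS; apply/card_gt0P; exists 1.
have dn (z : wreath gT n) : wr_deg z <= n by rewrite -[X in _ <= X](wr_deg_triv z) leq_addr.
have h : q ^ n <= q ^ (n - wr_deg (x * y)) * q ^ (wr_deg x + wr_deg y).
  have -> : (q ^ n)%N = #|gain_sol [::]|.
    have -> : gain_sol [::] = setT by apply/setP => f; rewrite !inE.
    by rewrite cardsT card_ffun card_option card_ord.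
  apply: (leq_trans (card_gain_cat [::] (gain_eqs x ++ gain_eqs y))).
  rewrite cats0 size_cat !size_gain_eqs leq_mul2r; apply/orP; right.
  have -> : n - wr_deg (x * y) = #|base_points (x * y)|.
    by rewrite -[X in X - _](wr_deg_triv (x * y)) addKn card_base_points.
  apply: leq_trans (card_fix_sol _); apply: subset_leq_card; apply/subsetP => f.
  rewrite inE all_cat => /andP[fx fy].
  by apply: fix_solM; apply: gain_eqs_fix; rewrite inE.
move: h; rewrite -expnD leq_exp2l // -{1}(subnK (dn (x * y))) leq_add2l.
exact.
Qed.

End GainEquations.

Section Coefficients.
Variables (R : nzRingType) (G : finGroupType).
Local Open Scope ring_scope.

Definition gring_coef (x : G) (f : group_ring R G) : R := f x.

Fact gring_coef_additive x : zmod_morphism (gring_coef x).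
Proof. by move=> f g; rewrite /gring_coef !ffunE. Qed.

HB.instance Definition _ x := GRing.isZmodMorphism.Build (group_ring R G) R
  (gring_coef x) (gring_coef_additive x).

Lemma gring_eltMl (f : group_ring R G) x z : (gring_elt R z * f) x = f (z^-1 * x)%g.
Proof.
rewrite group_ringM (bigD1 z) //= big1 => [|y /negPf yz]; rewrite ffunE.
  by rewrite eqxx mul1r addr0.
by rewrite yz mul0r.
Qed.

Lemma gring_eltMr (f : group_ring R G) x z : (f * gring_elt R z) x = f (x * z^-1)%g.
Proof.
rewrite group_ringM (bigD1 (x * z^-1)%g) //= big1 => [|y yz]; rewrite ffunE.
  by rewrite invMg invgK mulgKV eqxx mulr1 addr0.
rewrite [_ == z](_ : _ = false) ?mulr0 //; apply: contra_neqF yz => /eqP <-.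
by rewrite invMg invgK mulKVg.
Qed.

Lemma central_conj (f : group_ring R G) x z :
  f \in @central (group_ring R G) -> f (z * x * z^-1)%g = f x.
Proof.
move=> /asboolP/(_ (gring_elt R z)) /ffunP/(_ (z * x)%g).
by rewrite gring_eltMl gring_eltMr mulKg.
Qed.

End Coefficients.

Section Filtration.
Variables (gT : finGroupType) (n : nat).
Local Open Scope ring_scope.

Local Notation ZG := (group_ring int (wreath gT n)).
Implicit Types (x y : wreath gT n) (w v : center ZG) (lam : part_fun gT).

Lemma class_sumE lam x : class_sum n lam x = (modified_type x == lam)%:R.
Proof.
rewrite -[LHS]/(gring_coef x _) raddf_sum /= big_mkcond (bigD1 x) //= big1 => [|y /negPf yx].
  by rewrite addr0 /gring_coef ffunE eqxx; case: eqP.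
by case: ifP => // _; rewrite /gring_coef ffunE eq_sym yx.
Qed.

Lemma center_filP k w : reflect (forall x, val w x != 0 -> wr_deg x <= k)%N
  (w \in center_fil gT n k).
Proof.
apply: (iffP (asboolP _)) => [[s [/allP sk ->]] x|H].
  rewrite -[X in X != _]/(gring_coef x _) raddf_sum /= => s0.
  case: (boolP (has (fun p => modified_type x == p.2) s)) => [/hasP[p ps /eqP e]|].
    by rewrite /wr_deg e sk.
  move=> /hasPn h; case/eqP: s0; apply: big1_seq => p /andP[_ /h /negPf pn].
  by rewrite raddfMz /= /gring_coef class_sumE pn mul0rz.
pose a lam := if [pick x | modified_type x == lam] is Some x then val w x else 0.
have aE x : a (modified_type x) = val w x.
  rewrite /a; case: pickP => [y /eqP e|/(_ x)]; last by rewrite eqxx.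
  by have [z ->] := wr_conj e; rewrite central_conj //; exact: valP.
pose T := undup [seq modified_type x | x <- enum [set x | (wr_deg x <= k)%N]].
exists [seq (a lam, lam) | lam <- T]; split.
  apply/allP => _ /mapP[lam + ->]; rewrite mem_undup => /mapP[x + ->] /=.
  by rewrite mem_enum inE.
apply/ffunP => x; rewrite -[RHS]/(gring_coef x _) raddf_sum big_map /=.
under eq_bigr do rewrite raddfMz /= /gring_coef class_sumE.
case: (boolP (modified_type x \in T)) => xT.
  rewrite (bigD1_seq (modified_type x)) ?undup_uniq //= eqxx aE intz.
  by rewrite big1 ?addr0 // => lam /negPf; rewrite eq_sym => ->; rewrite mul0rz.
rewrite big1_seq => [|lam /andP[_ lT]]; last first.
  by case: eqP lT xT => [->->|]; rewrite // mul0rz.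
apply/eqP; apply: contraNT xT => /H dx; rewrite mem_undup; apply/mapP.
by exists x; rewrite // mem_enum inE.
Qed.

Fact center_fil_zmod k : zmod_closed (center_fil gT n k).
Proof.
split=> [|w v /center_filP hw /center_filP hv]; apply/center_filP => x.
  by rewrite /= ffunE eqxx.
rewrite /= !ffunE => h; have [w0|/hw //] := eqVneq (val w x) 0.
by apply: hv; apply: contraNneq h => v0; rewrite w0 v0 subr0.
Qed.

Fact center_fil_mono k : {subset center_fil gT n k <= center_fil gT n k.+1}.
Proof. by move=> w /center_filP H; apply/center_filP => x /H /leqW. Qed.

Fact center_fil_one : 1 \in center_fil gT n 0.
Proof.
apply/center_filP => x; rewrite /= ffunE.
have [->|_] := eqVneq x 1%g; last by rewrite eqxx.
move=> _; rewrite -(leq_add2r #|cycles_in (1 : wreath gT n)%g (class_of 1%g)|) wr_deg_triv.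
rewrite add0n -card_base_points -[X in (X <= _)%N]card_ord -cardsT subset_leq_card //.
apply/subsetP => i _; rewrite inE /cyc_loop expg1n ffunE eqxx andbT.
have := cyc_rep_porbit 1 i; rewrite -[in X in X -> _]eq_porbit_mem.
by move/eqP/setP/(_ i); rewrite porbit_id => /porbitP[k ->]; rewrite expg1n perm1 cyc_rep_id.
Qed.

Fact center_fil_mul i j w v :
  w \in center_fil gT n i -> v \in center_fil gT n j ->
  w * v \in center_fil gT n (i + j).
Proof.
move=> /center_filP hw /center_filP hv; apply/center_filP => x.
rewrite /= group_ringM => s0.
have [y yP|H] := pickP (fun y => val w y * val v (y^-1 * x)%g != 0); last first.
  by case/eqP: s0; apply: big1 => y _; apply/eqP/negbFE/H.
move: yP; rewrite mulf_eq0 negb_or => /andP[/hw dy /hv dx].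
by rewrite -[x](mulKVg y) (leq_trans (wr_degM _ _)) // leq_add.
Qed.

Definition center_filtration : filtration (center ZG) :=
  Filtration center_fil_zmod center_fil_mono center_fil_one center_fil_mul.

Definition graded_center := assoc_graded center_filtration.

End Filtration.

(* Main.v *)
From HB Require Import structures.
Require Import Defs.
From mathcomp Require Import all_boot all_order all_algebra all_fingroup.
From mathcomp Require Import boolp zify ring.
From mathcomp Require Import reals complex.

Set Implicit Arguments.
Unset Strict Implicit.
Unset Printing Implicit Defensive.

Import Order.TTheory GRing.Theory Num.Theory.

(** The graded product of two class functions on the wreath product only sees
the factorizations z = x y with wr_deg x + wr_deg y = wr_deg z. The idea is to
refine such factorizations into minimal words in elements of degree at most 1
and to compare these words for the two groups.

Words. The elements of degree at most 1 are the reflections [refl (i, j, g)]: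
a transposition of i and j with gain g when i <> j, and the label g put at i
when i = j. The degree is a word length for them ([reduced_word],
[wr_deg_word]), so that an additive factorization of z together with minimal
words for both factors is the same thing as a minimal word for z cut in two.

Words with fixed edges. Fix the pairs (i, j) of a word and let the labels vary;
they form a graph on 'I_n. The functions 'I_n -> gT act on the labels
([gauge]), by conjugation on the product. The labels on a spanning forest can be
made trivial, each labelling being obtained equally often ([sum_normal]). If
the word is minimal and normal, then [reduced_normal] says that each component of the
graph carries at most one further edge, and that its label g is not 1. The
non-trivial labels of the product of such a word, and of the product of any of
its subwords, are then g and possibly g^-1, each at one point at most of the
component. Hence the modified types of these products only depend on the
conjugacy classes of the labels, through the set of classes with its involution
and its trivial class ([matched_modified_type]).

Weights. Counting labels introduces the sizes of the classes. They are absorbed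
by a weight 1 / s_c on every reflection with i = j and a label of class c, and
by a factor s_c for every cycle of class c of the product, where
s_c = sqrt (#|c| / #|gT|) for c <> 1 and s_1 = 1 ([reduced_weight]). It follows
that the weighted sums over words cut in two are the same for gT and for hT,
after division by S #|gT| ^ wr_deg z and S' #|hT| ^ wr_deg z, where S and S' are
the products of these factors ([label_sum_eq], [pair_term_transfer]).

Conclusion. Let R x > 0 be the sum of the weights of the minimal words for x.
The transfer makes u x / R x = u' x' / R' x', for x and x' of corresponding
types, a correspondence between class functions that is compatible with the
graded products ([graded_conv_corresponds]). Finally, the tensor product of the
field with the graded ring is identified with the class functions under the
graded product, through the leading coefficients ([tensor_valM],
[tensor_val_inj], [tensor_ofE]). *)

(** * Words in reflections *)

Section Reflections.
Variables (gT : finGroupType) (n : nat).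
Local Open Scope group_scope.
Local Notation edge := ('I_n * 'I_n)%type.
Local Notation ledge := (edge * gT)%type.
Implicit Types (x y z : wreath gT n) (r : ledge) (w : seq ledge).

(** A labelled edge (i, j, g) gives the element that exchanges i and j with
gains g and g^-1. For i = j the second test below is never reached and the
permutation is trivial: what remains is the label g at i. *)
Definition refl r : wreath gT n :=
  ([ffun k => if k == r.1.1 then r.2 else if k == r.1.2 then r.2^-1 else 1],
   tperm r.1.1 r.1.2).

Definition word_prod w := \prod_(r <- w) refl r.

Lemma wrV2 x : (x^-1).2 = (x.2)^-1.
Proof. by []. Qed.

Lemma wrV1 x i : (x^-1).1 i = (x.1 (x.2 i))^-1.
Proof. by rewrite ffunE. Qed.

Lemma refl_conj z r : z * refl r * z^-1 =
  refl (z.2 r.1.1, z.2 r.1.2, z.1 (z.2 r.1.1) * r.2 * (z.1 (z.2 r.1.2))^-1).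
Proof.
case: r => [[i j] g] /=; apply: wr_ext => [k|]; last first.
  by rewrite !wrM2 wrV2 /= -tpermJ conjgE mulgA.
rewrite !wrM1 wrM2 wrV1 !ffunE /= invMg permM tpermV.
have -> : z.2 (tperm i j (z.2^-1 k)) = tperm (z.2 i) (z.2 j) k.
  by rewrite -tpermJ conjgE !permM.
rewrite -[z.2^-1 k == i](inj_eq (@perm_inj _ z.2)) -[z.2^-1 k == j](inj_eq (@perm_inj _ z.2)).
rewrite !permKV.
case: eqP => [->|/eqP ki]; first by rewrite tpermL.
case: eqP => [->|/eqP kj]; first by rewrite tpermR !invMg invgK mulgA.
by rewrite mulg1 tpermD ?mulgV // eq_sym.
Qed.

Lemma fix_sol_refl (f : {ffun 'I_n -> option gT}) r :
  f r.1.1 = opt_lmul r.2 (f r.1.2) -> f \in fix_sol (refl r).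
Proof.
case: r => [[i j] g] /= e; apply/fix_solP => k; rewrite ffunE /=.
case: tpermP => [->|->|/eqP ki /eqP kj].
- rewrite eqxx; case: eqP => [ji|_]; first by rewrite -{1}ji {1}ji e ji.
  by rewrite e opt_lmulK.
- by rewrite eqxx e.
by rewrite (negPf ki) (negPf kj) opt_lmul1.
Qed.

Lemma fix_solV x (f : {ffun 'I_n -> option gT}) : f \in fix_sol x -> f \in fix_sol x^-1.
Proof.
move=> /fix_solP fx; apply/fix_solP => i; rewrite wrV1 wrV2.
by rewrite -[in RHS](permKV x.2 i) fx !permKV opt_lmulK.
Qed.

Lemma card_gain_sol_nil : #|gain_sol ([::] : seq ledge)| = (#|gT|.+1 ^ n)%N.
Proof.
have -> : gain_sol ([::] : seq ledge) = setT by apply/setP => f; rewrite !inE.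
by rewrite cardsT card_ffun card_option card_ord.
Qed.

(** The number of fixed functions determines the degree, so that degrees can be
compared through inclusions of sets of fixed functions. *)
Lemma card_fix_solE x : #|fix_sol x| = (#|gT|.+1 ^ (n - wr_deg x))%N.
Proof.
have dn : wr_deg x <= n by rewrite -[X in _ <= X](wr_deg_triv x) leq_addr.
apply/eqP; rewrite eqn_leq; apply/andP; split.
  apply: leq_trans (card_fix_sol x) _; rewrite card_base_points.
  by rewrite -[X in X - _](wr_deg_triv x) addKn.
have q0 : 0 < #|gT|.+1 ^ wr_deg x by rewrite expn_gt0.
rewrite -(leq_pmul2r q0) -expnD subnK // -(size_gain_eqs x).
rewrite -card_gain_sol_nil (leq_trans (card_gain_cat [::] (gain_eqs x))) //.
rewrite cats0 leq_mul2r subset_leq_card ?orbT //.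
by apply/subsetP => f; apply: gain_eqs_fix.
Qed.

Lemma wr_deg_le x : wr_deg x <= n.
Proof. by rewrite -[X in _ <= X](wr_deg_triv x) leq_addr. Qed.

Lemma fix_sol_deg x y : fix_sol x \subset fix_sol y -> wr_deg y <= wr_deg x.
Proof.
move/subset_leq_card; rewrite !card_fix_solE leq_exp2l; last first.
  by rewrite ltnS; apply/card_gt0P; exists 1.
by rewrite leq_sub2lE ?wr_deg_le.
Qed.

Lemma fix_sol_deg_lt x y : fix_sol x \proper fix_sol y -> wr_deg y < wr_deg x.
Proof.
move=> h; rewrite ltn_neqAle fix_sol_deg ?proper_sub // andbT.
by apply: contraTneq (proper_card h) => e; rewrite !card_fix_solE e ltnn.
Qed.

Lemma wr_deg_refl r : wr_deg (refl r) <= 1.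
Proof.
have q1 : 1 < #|gT|.+1 by rewrite ltnS; apply/card_gt0P; exists 1.
have h : #|gT|.+1 ^ n <= #|fix_sol (refl r)| * #|gT|.+1 ^ 1.
  rewrite -card_gain_sol_nil (leq_trans (card_gain_cat [::] [:: r])) //.
  rewrite leq_mul2r subset_leq_card ?orbT //.
  apply/subsetP => f; rewrite inE /= andbT => /eqP; exact: fix_sol_refl.
move: h; rewrite card_fix_solE -expnD leq_exp2l // -(leq_add2r (wr_deg (refl r))).
by rewrite addnAC subnK ?wr_deg_le // leq_add2l.
Qed.

Lemma word_prod_cons r w : word_prod (r :: w) = refl r * word_prod w.
Proof. exact: big_cons. Qed.

Lemma wr_deg1 : wr_deg (1 : wreath gT n) = 0%N.
Proof.
have := card_fix_solE 1; rewrite (_ : fix_sol 1 = setT).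
  rewrite cardsT card_ffun card_option card_ord => /eqP.
  rewrite eqn_exp2l ?ltnS; last by apply/card_gt0P; exists 1.
  by move=> /eqP h; apply/eqP; rewrite -(eqn_add2l n) addn0 {1}h subnK ?wr_deg_le.
by apply/setP => f; rewrite in_setT; apply/fix_solP => i; rewrite perm1 ffunE opt_lmul1.
Qed.

Lemma wr_deg_word w : wr_deg (word_prod w) <= size w.
Proof.
elim: w => [|r w IH]; first by rewrite /word_prod big_nil wr_deg1.
rewrite word_prod_cons (leq_trans (wr_degM _ _)) //= -add1n leq_add //.
exact: wr_deg_refl.
Qed.

(** The function equal to 1 at i and undefined elsewhere. *)
Definition ind_sol i : {ffun 'I_n -> option gT} :=
  [ffun k => if k == i then Some 1 else None].

Lemma ind_sol_fix x i : x.2 i = i -> x.1 i = 1 -> ind_sol i \in fix_sol x.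
Proof.
move=> x2 x1; apply/fix_solP => k; rewrite !ffunE.
have [->|ki] := eqVneq k i; first by rewrite x2 eqxx x1 opt_lmul1.
by rewrite -{1}x2 (inj_eq perm_inj) (negPf ki).
Qed.

(** A reflection that fixes all the functions fixed by x is split off, in such a
way that one more function, [ind_sol i], becomes fixed. *)
Lemma deg_decrease x : x != 1 -> exists r, wr_deg ((refl r)^-1 * x) < wr_deg x.
Proof.
move=> x1.
suff [r [i [h1 h2 h3]]] : exists r i, [/\ fix_sol x \subset fix_sol (refl r),
    ind_sol i \in fix_sol ((refl r)^-1 * x) & ind_sol i \notin fix_sol x].
  exists r; apply: fix_sol_deg_lt; apply/properP; split; last by exists (ind_sol i).
  by apply/subsetP => f fx; rewrite fix_solM // fix_solV // (subsetP h1).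
have [i xi|fixed] := pickP (fun i => x.2 i != i).
  exists (x.2 i, i, x.1 (x.2 i)), i; split.
  - by apply/subsetP => f /fix_solP fx; apply: fix_sol_refl; rewrite /= fx.
  - apply: ind_sol_fix; first by rewrite wrM2 wrV2 permM /= tpermV tpermL.
    by rewrite wrM1 wrV1 wrV2 invgK /= tpermR !ffunE /= eqxx mulVg.
  - apply/negP => /fix_solP/(_ i); rewrite !ffunE eqxx (negPf xi) => //.
have x2 : x.2 = 1 by apply/permP => i; rewrite perm1; apply/eqP/negbFE/fixed.
have [i xi|fixed1] := pickP (fun i => x.1 i != 1); last first.
  case/eqP: x1; apply: wr_ext => // i; rewrite [RHS]ffunE.
  by apply/eqP/negbFE/fixed1.
exists (i, i, x.1 i), i; split.
- by apply/subsetP => f /fix_solP fx; apply: fix_sol_refl; have := fx i; rewrite x2 perm1.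
- apply: ind_sol_fix; first by rewrite wrM2 wrV2 permM /= tpermV x2 perm1 tpermL.
  by rewrite wrM1 wrV1 wrV2 invgK /= tpermR !ffunE /= eqxx mulVg.
- apply/negP => /fix_solP/(_ i); rewrite x2 perm1 !ffunE eqxx /= => -[] /esym/eqP.
  by rewrite mulg1 (negPf xi).
Qed.

(** The degree is the word length with respect to the reflections. *)
Lemma reduced_word x : exists2 w, size w = wr_deg x & word_prod w = x.
Proof.
suff [w sw wE] : exists2 w, size w <= wr_deg x & word_prod w = x.
  by exists w => //; apply/eqP; rewrite eqn_leq sw -wE wr_deg_word.
elim: {x}(wr_deg x) {-2}x (leqnn (wr_deg x)) => [|d IH] x dx.
  have [->|/deg_decrease[r]] := eqVneq x 1; first by exists [::]; rewrite // /word_prod big_nil.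
  by move=> rx; have := leq_trans rx dx.
have [->|/deg_decrease[r rx]] := eqVneq x 1; first by exists [::]; rewrite // /word_prod big_nil.
have [|w sw wE] := IH ((refl r)^-1 * x); first by rewrite -ltnS (leq_trans rx).
exists (r :: w); [exact: leq_ltn_trans sw rx | by rewrite word_prod_cons wE mulKVg].
Qed.

End Reflections.

(** * Colours of the components, and the gauge action *)

Section Colours.
Variable n : nat.
Local Notation edge := ('I_n * 'I_n)%type.
Implicit Types (e : seq edge) (v : 'I_n).

(** The connected components of the graph with edges e: colour e v is a vertex
that represents the component of v. The edges are added from the right, the
component of r.2 receiving the colour of that of r.1. *)
Fixpoint colour e : 'I_n -> 'I_n :=
  if e is r :: e' then
    fun v => if colour e' v == colour e' r.2 then colour e' r.1 else colour e' v
  else id.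

(** The number of edges that join two different components when they are added;
they form a spanning forest. *)
Fixpoint forest_size e : nat :=
  if e is r :: e' then (colour e' r.1 != colour e' r.2) + forest_size e' else 0.

Lemma colour_idem e v : colour e (colour e v) = colour e v.
Proof.
elim: e v => //= r e IH v; case: (eqVneq (colour e v)) => [_|h].
  by rewrite IH; case: ifP.
by rewrite IH (negPf h).
Qed.

Lemma colour_edge e r : r \in e -> colour e r.1 = colour e r.2.
Proof.
elim: e => //= s e IH; rewrite inE => /orP[/eqP->|/IH ->] //.
by rewrite eqxx; case: ifP.
Qed.

Lemma card_roots e : #|[set v | colour e v == v]| + forest_size e = n.
Proof.
elim: e => [|r e IH] /=.
  rewrite addn0 -[RHS]card_ord -cardsT; apply: eq_card => v; by rewrite !inE eqxx.
have [h|h] /= := eqVneq (colour e r.1) (colour e r.2).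
  rewrite add0n -[RHS]IH; congr (_ + _); apply: eq_card => v; rewrite !inE.
  by case: ifP => // /eqP ->; rewrite h.
rewrite addnA addn1 -[RHS]IH; congr (_ + _).
have rin : colour e r.2 \in [set v | colour e v == v] by rewrite inE colour_idem.
rewrite [RHS](cardsD1 (colour e r.2)) rin add1n; congr _.+1.
apply: eq_card => v; rewrite !inE; case: (eqVneq (colour e v)) => [vj|vj].
  have [_|vr] := eqVneq v (colour e r.2).
    by apply/eqP=> ij; case/eqP: h; rewrite -colour_idem ij vj.
  rewrite /= vj [RHS]eq_sym (negPf vr); apply/eqP => iv.
  by case/eqP: h; rewrite -vj -iv colour_idem.
suff -> : v != colour e r.2 by [].
by apply: contraNneq vj => ->; rewrite colour_idem.
Qed.

End Colours.

Section Gauge.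
Variables (gT : finGroupType) (n : nat).
Local Open Scope group_scope.
Local Notation edge := ('I_n * 'I_n)%type.
Local Notation ledge := (edge * gT)%type.
Local Notation Gauge := {ffun 'I_n -> gT}.
Implicit Types (r : ledge) (w : seq ledge) (t : Gauge).

(** All the edges of the spanning forest have trivial label. *)
Fixpoint normal w : bool :=
  if w is r :: w' then
    ((colour (unzip1 w') r.1.1 != colour (unzip1 w') r.1.2) ==> (r.2 == 1)) && normal w'
  else true.

(** The action of t : 'I_n -> gT on labelled edges, which corresponds to the
conjugation of the product by (t, 1). *)
Definition gauge t r : ledge := (r.1, t r.1.1 * r.2 * (t r.1.2)^-1).

Lemma unzip1_gauge t w : unzip1 [seq gauge t r | r <- w] = unzip1 w.
Proof. by rewrite /unzip1 -map_comp. Qed.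

Lemma normal_gauge_eq t t' w :
  (forall r, r \in w -> ((gauge t r).2 == 1) = ((gauge t' r).2 == 1)) ->
  normal [seq gauge t r | r <- w] = normal [seq gauge t' r | r <- w].
Proof.
elim: w => //= r w IH H; rewrite !unzip1_gauge H ?mem_head // IH // => s sw.
by rewrite H // inE sw orbT.
Qed.

(** Every labelling can be made normal, by #|gT| ^ c gauges where c is the number
of components. *)
Lemma card_gauge w :
  (#|[set t : Gauge | normal [seq gauge t r | r <- w]]| * #|gT| ^ forest_size (unzip1 w)
   = #|gT| ^ n)%N.
Proof.
elim: w => [|r w IH] /=.
  rewrite expn0 muln1 -[in RHS](card_ord n) -card_ffun -cardsT.
  by apply: eq_card => t; rewrite !inE.
rewrite -[RHS]IH expnD mulnA; congr (_ * _)%N.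
set kappa := colour (unzip1 w); have [h|h] /= := eqVneq (kappa r.1.1) (kappa r.1.2).
  by rewrite expn0 muln1; apply: eq_card => t; rewrite !inE unzip1_gauge -/kappa h eqxx.
set A := [set t : Gauge | normal _ ]; rewrite expn1.
set B := [set t : Gauge | _ ].
(* Multiplying t by a constant on the component of r.1.2 does not affect the
   edges already present and translates the label of r. *)
pose shift (a : gT) t : Gauge := [ffun v => if kappa v == kappa r.1.2 then a * t v else t v].
have shift_inj a : injective (shift a).
  move=> t t' /ffunP e; apply/ffunP => v; have := e v; rewrite !ffunE.
  by case: ifP => // _ /mulgI.
have pre a : #|[set t in A | (gauge t r).2 == a]| = #|B|.
  rewrite -[RHS](card_preimset _ (shift_inj a)); apply: eq_card => t.
  (* The shift moves the endpoint r.1.2 but not r.1.1, and both endpoints or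
     none of each edge of w. *)
  rewrite !inE !unzip1_gauge -/kappa h /= !ffunE eqxx (negPf h) invMg !mulgA.
  rewrite -(eq_mulgV1 (t r.1.1 * r.2 * (t r.1.2)^-1) a) andbC; congr (_ && _).
  apply: normal_gauge_eq => s sw /=.
  rewrite !ffunE; have -> : kappa s.1.1 = kappa s.1.2 by apply: colour_edge; apply: map_f.
  case: ifP => // _; rewrite invMg !mulgA -[LHS](inj_eq (mulIg a^-1)) mul1g.
  by rewrite -[LHS](inj_eq (mulgI a)) mulgV !mulgA.
rewrite -[RHS]sum1_card (partition_big (fun t => (gauge t r).2) predT) //=.
transitivity (\sum_(a : gT) #|B|)%N; first by rewrite sum_nat_const mulnC.
by apply: eq_bigr => a _; rewrite -(pre a) -sum1_card; apply: eq_bigl => t; rewrite inE.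
Qed.

End Gauge.

(** * Products with one non-trivial label in each component *)

Section SignedLabels.
Variables (n : nat) (J : eqType) (e : J -> 'I_n * 'I_n).
Variables (fl : pred J) (kappa : 'I_n -> 'I_n).
Local Open Scope group_scope.
Implicit Types (s : seq J) (i j v : 'I_n) (k : J) (o : option (bool * J)).

(** Symbolic computation of the label at i of the product of the word of indices
s, where J indexes the edges and fl selects those whose label may be
non-trivial: Some (true, k) stands for the label of k, Some (false, k) for its
inverse, and None for 1. It is correct when the selected edges of s lie in
different components, see [word_prod_mark]; it does not depend on the group. *)
Fixpoint mark s i : option (bool * J) :=
  if s is k :: s' then
    if fl k && (i == (e k).1) then Some (true, k)
    else if fl k && (i == (e k).2) then Some (false, k)
    else mark s' (tperm (e k).1 (e k).2 i)
  else None.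

(** Here kappa is any colouring of the vertices that is constant on the edges; for
a subword it will be the colouring of the whole word. *)
Definition monochromatic s := all (fun k => kappa (e k).1 == kappa (e k).2) s.
(** The colours of the selected edges of s, with multiplicity. *)
Definition colours s := [seq kappa (e k).1 | k <- s & fl k].

Lemma kappa_tperm k i : kappa (e k).1 = kappa (e k).2 ->
  kappa (tperm (e k).1 (e k).2 i) = kappa i.
Proof. by move=> h; case: tpermP => [->|->|]. Qed.

Lemma markP s i b k : monochromatic s -> mark s i = Some (b, k) ->
  [/\ k \in s, fl k & kappa (e k).1 = kappa i].
Proof.
elim: s i => //= h s IH i /andP[/eqP hm sm].
case: ifP => [/andP[fh /eqP ->] [_ <-]|_]; first by rewrite mem_head.
case: ifP => [/andP[fh /eqP ->] [_ <-]|_]; first by rewrite mem_head.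
by case/(IH _ sm) => ks fk kk; split; rewrite // ?inE ?ks ?orbT // kk kappa_tperm.
Qed.

Lemma mark_none s i : monochromatic s -> kappa i \notin colours s -> mark s i = None.
Proof.
move=> sm; case E: (mark s i) => [[b k]|] //.
by case: (markP sm E) => ks fk <- /negP[]; apply: map_f; rewrite mem_filter fk.
Qed.

Lemma mark_inj s i j : monochromatic s -> uniq (colours s) ->
  mark s i = mark s j -> mark s i <> None -> i = j.
Proof.
elim: s i j => //= k s IH i j /andP[/eqP km sm].
rewrite /colours /=; case: ifP => fk; last by move=> u h N; apply: perm_inj (IH _ _ sm u h N).
move=> /= /andP[ks su].
have N v b : mark s v <> Some (b, k).
  by case/(markP sm) => kin _ _; case/negP: ks; apply/mapP; exists k; rewrite // mem_filter fk.
case: (eqVneq i (e k).1) => ia; case: (eqVneq j (e k).1) => ja;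
  case: (eqVneq i (e k).2) => ib; case: (eqVneq j (e k).2) => jb //=;
  try by [move=> /esym /N | move=> /N | rewrite ?ia ?ja ?ib ?jb].
by move=> h N'; apply: perm_inj (IH _ _ sm su h N').
Qed.

Lemma mark_colour s i j b b' k k' :
  monochromatic s -> uniq (colours s) -> kappa i = kappa j ->
  mark s i = Some (b, k) -> mark s j = Some (b', k') -> k = k'.
Proof.
move=> sm su ij /(markP sm)[ks fk ki] /(markP sm)[ks' fk' kj].
have: {in [seq k <- s | fl k] &, injective (fun k => kappa (e k).1)}.
  move: su; rewrite /colours; elim: (filter _ _) => //= h s' IH /andP[h1 /IH h2] a c; rewrite !inE.
  case: eqP => [->|_]; case: eqP => [->|_] //= ain cin E.
  - by case/negP: h1; rewrite E; apply: (map_f (fun k => kappa (e k).1)).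
  - by case/negP: h1; rewrite -E; apply: (map_f (fun k => kappa (e k).1)).
  exact: h2.
by apply; rewrite ?mem_filter ?fk ?fk' // ki kj.
Qed.

(** The product of the labels m i along t, provided that two labels that are not
None are always inverse to each other. *)
Fixpoint signed_total (m : 'I_n -> option (bool * J)) (t : seq 'I_n) :=
  if t is i :: t' then
    match m i, signed_total m t' with None, o => o | o, None => o | Some _, Some _ => None end
  else None.

Variable gT : finGroupType.
Variable l : J -> gT.

(** The element of the group that a symbolic label stands for. *)
Definition signed_label o : gT :=
  if o is Some (b, k) then if b then l k else (l k)^-1 else 1.

Definition word s := [seq (e k, l k) | k <- s].

Lemma word_cons k s : word_prod (word (k :: s)) = refl (e k, l k) * word_prod (word s).
Proof. exact: word_prod_cons. Qed.

Lemma word_prod_mark s i :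
  monochromatic s -> uniq (colours s) -> (forall k, ~~ fl k -> l k = 1) ->
  (word_prod (word s)).1 i = signed_label (mark s i).
Proof.
move=> + + l1; elim: s i => [|k s IH] i; first by rewrite /word_prod big_nil ffunE.
rewrite word_cons wrM1 /= tpermV => /andP[/eqP km sm].
rewrite /colours /= !ffunE /=; case: ifP => fk /=; last first.
  move=> u; rewrite IH // l1 ?fk // invg1.
  by rewrite !if_same mul1g.
move=> /andP[ks su]; rewrite IH //.
have none v : kappa v = kappa (e k).1 -> mark s v = None by move=> h; rewrite mark_none ?h.
case: eqP => [->|_]; first by rewrite tpermL none ?mulg1.
case: eqP => [->|_]; first by rewrite tpermR none ?mulg1.
by rewrite mul1g.
Qed.

Lemma signed_total_exists m t b k : signed_total m t = Some (b, k) ->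
  exists2 i, i \in t & m i = Some (b, k).
Proof.
elim: t => //= i t IH; case E: (m i) => [[b' k']|]; case F: (signed_total m t) => [[b'' k'']|] //.
  by move=> [<- <-]; exists i; rewrite ?mem_head.
by move/(etrans F)/IH => [j jt mj]; exists j; rewrite // inE jt orbT.
Qed.

Section Total.
Variables (s : seq J) (v0 : 'I_n).
Hypotheses (sm : monochromatic s) (su : uniq (colours s)).
Local Notation m := (mark s).

Lemma prod_signed_total t : uniq t -> {in t, forall v, kappa v = kappa v0} ->
  \prod_(v <- t) signed_label (m v) = signed_label (signed_total m t).
Proof.
elim: t => [|i t IH] /=; first by rewrite big_nil.
move=> /andP[it ut] tc; have tc' : {in t, forall v, kappa v = kappa v0}.
  by move=> v vt; apply: tc; rewrite inE vt orbT.
rewrite big_cons IH //; case E: (m i) => [[b k]|]; last by rewrite mul1g; case: signed_total.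
case F: (signed_total m t) => [[b' k']|]; last by rewrite mulg1.
have [j jt mj] := signed_total_exists F.
have kk : k = k'.
  by apply: (mark_colour sm su _ E mj); rewrite tc ?mem_head // tc'.
have bb : b' <> b.
  move=> bb; case/negP: it; suff -> : i = j by [].
  by apply: (mark_inj sm su); rewrite E // mj kk bb.
rewrite kk; case: b b' bb {E F mj} => -[] //= _; rewrite ?mulgV ?mulVg //.
Qed.

Variables (R : comPzRingType) (f : gT -> R).
Hypothesis f1 : f 1 = 1%R.

(** A function with f 1 = 1 is multiplicative along t if a marked vertex in t
prevents the total from being trivial: at most two vertices of a given colour
are marked, and two marks cancel, so that exactly one vertex of t is marked. *)
Lemma scalar_signed_total t : uniq t -> {in t, forall v, kappa v = kappa v0} ->
  (forall v, v \in t -> m v <> None -> signed_total m t <> None) ->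
  (\prod_(v <- t) f (signed_label (m v)) = f (signed_label (signed_total m t)))%R.
Proof.
have tot_filter u : signed_total m u = signed_total m [seq v <- u | m v != None].
  by elim: u => //= i u ->; case E: (m i) => [o|] //=; rewrite E.
move=> ut tc H; have {H}H : [seq v <- t | m v != None] != [::] -> signed_total m t <> None.
  case F: (filter _ _) => [|v u] // _; apply: (H v); have : v \in v :: u by rewrite mem_head.
    by rewrite -F mem_filter => /andP[].
  by rewrite -F mem_filter => /andP[/eqP].
have -> : (\prod_(v <- t) f (signed_label (m v)) =
           \prod_(v <- t | m v != None) f (signed_label (m v)))%R.
  by rewrite [RHS]big_mkcond; apply: eq_bigr => v _; case: eqP => //= ->.
rewrite -big_filter tot_filter in H *.
have tfc : {in [seq v <- t | m v != None], forall v, kappa v = kappa v0}.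
  by move=> v; rewrite mem_filter => /andP[_ /tc].
have tfm : {in [seq v <- t | m v != None], forall v, m v <> None}.
  by move=> v; rewrite mem_filter => /andP[/eqP].
move: (filter_uniq (fun v => m v != None) ut) H tfc tfm.
case: (filter _ _) => [|i [|j [|h u]]] /=; first by rewrite big_nil.
- by rewrite big_seq1; case: (m i).
- move=> _ /(_ isT) + _ H; have := H i (mem_head _ _); case: (m i) => [[b k]|] //.
  by have := H j; rewrite !inE eqxx orbT => /(_ isT); case: (m j).
(* Three marked vertices of the same colour: two of them have the same sign. *)
rewrite !inE => /andP[/norP[/eqP ij /norP[/eqP ih _]] /andP[/norP[/eqP jh _] _]] _ H1 H2.
exfalso.
have mem : [/\ i \in [:: i, j, h & u], j \in [:: i, j, h & u] & h \in [:: i, j, h & u]].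
  by rewrite !inE !eqxx !orbT.
case: mem => iin jin hin.
have [[mi mj] mh] := (H2 i iin, H2 j jin, H2 h hin).
have [[ci cj] ch] := (H1 i iin, H1 j jin, H1 h hin).
have I := mark_inj sm su.
have C a c : kappa a = kappa v0 -> kappa c = kappa v0 -> forall b b' k k',
   mark s a = Some (b, k) -> mark s c = Some (b', k') -> k = k'.
  by move=> ea ec b b' k k'; apply: mark_colour; rewrite // ea ec.
case Ei: (mark s i) mi => [[bi ki]|] // _; case Ej: (mark s j) mj => [[bj kj]|] // _.
case Eh: (mark s h) mh => [[bh kh]|] // _.
have kij := C _ _ ci cj _ _ _ _ Ei Ej; have kih := C _ _ ci ch _ _ _ _ Ei Eh.
subst kj kh.
have Nij : bi <> bj by move=> b; apply: ij; apply: I; rewrite Ei // Ej b.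
have Nih : bi <> bh by move=> b; apply: ih; apply: I; rewrite Ei // Eh b.
have Njh : bj <> bh by move=> b; apply: jh; apply: I; rewrite Ej // Eh b.
by clear -Nij Nih Njh; case: bi Nij Nih; case: bj Njh; case: bh => *; congruence.
Qed.

End Total.

End SignedLabels.

(** * Reduced words in normal form *)

Section ReducedWords.
Variables (n : nat) (J : eqType) (e : J -> 'I_n * 'I_n) (gT : finGroupType) (l : J -> gT).
Local Open Scope group_scope.
Implicit Types (s : seq J) (i j v : 'I_n) (k : J) (x : wreath gT n).

(** The edges with a non-trivial label. *)
Definition nontriv k := l k != 1.
Definition edges s := [seq e k | k <- s].
Definition wprod s : wreath gT n := word_prod (word e l s).

(** The points of the cycle of i, in the order used by cycle_product. *)
Definition orbit_seq x i := rev (traject x.2 i #|porbit x.2 i|).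

Lemma class_cycle_product x i : class_of (cyc_loop x i) = class_of (cycle_product x i).
Proof. by rewrite -[in RHS](permKV x.2 i) cycle_product_loop -[RHS]cyc_loop_class permKV. Qed.

Lemma orbit_seq_uniq x i : uniq (orbit_seq x i).
Proof. by rewrite rev_uniq uniq_traject_porbit. Qed.

Lemma mem_orbit_seq x i v : (v \in orbit_seq x i) = (v \in porbit x.2 i).
Proof. by rewrite mem_rev -porbit_traject. Qed.

Variable kappa : 'I_n -> 'I_n.

Lemma kappa_wprod s v : monochromatic e kappa s -> kappa ((wprod s).2 v) = kappa v.
Proof.
elim: s v => [|k s IH] v /=; first by rewrite /wprod /word_prod big_nil perm1.
by move=> /andP[/eqP km sm]; rewrite /wprod word_cons wrM2 permM /= kappa_tperm // IH.
Qed.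

Lemma kappa_porbit s i v :
  monochromatic e kappa s -> v \in porbit (wprod s).2 i -> kappa v = kappa i.
Proof.
move=> sm /porbitP[m ->]; elim: m => [|m IH]; first by rewrite perm1.
by rewrite expgSr permM kappa_wprod.
Qed.

(** The cycle-products are computed symbolically as well. *)
Lemma cycle_product_total s i : monochromatic e kappa s -> uniq (colours e nontriv kappa s) ->
  cycle_product (wprod s) i =
  signed_label l (signed_total (mark e nontriv s) (orbit_seq (wprod s) i)).
Proof.
move=> sm su; have l1 k : ~~ nontriv k -> l k = 1 by rewrite negbK => /eqP.
rewrite -(prod_signed_total _ (v0 := i) sm su) ?orbit_seq_uniq //; last first.
  by move=> v; rewrite mem_orbit_seq; apply: kappa_porbit.
by apply: eq_bigr => v _; apply: (word_prod_mark _ sm su l1).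
Qed.

Lemma forest_size_nontriv s : normal (word e l s) ->
  forest_size (edges s) + count nontriv s <= size s.
Proof.
elim: s => //= k s IH /andP[]; rewrite /unzip1 -map_comp -/(edges s) => h /IH {}IH.
rewrite addnACA -[X in _ <= X]add1n leq_add // {IH}.
by move: h; rewrite /nontriv; do 2!case: (_ == _).
Qed.

Lemma wprod_label1 s i :
  monochromatic e kappa s -> kappa i \notin colours e nontriv kappa s ->
  (wprod s).1 i = 1.
Proof.
elim: s i => [|k s IH] i; first by rewrite /wprod /word_prod big_nil ffunE.
rewrite /colours /= => /andP[/eqP km sm]; rewrite /wprod word_cons wrM1 tpermV /=.
rewrite ffunE /nontriv; case: eqP => /= [lk|_] ic.
  by rewrite IH ?kappa_tperm // lk invg1 !if_same mul1g.
move: ic; rewrite inE negb_or => /andP[ik ic].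
case: eqP => [E|_]; first by rewrite E eqxx in ik.
case: eqP => [E|_]; first by rewrite E km eqxx in ik.
by rewrite mul1g IH ?kappa_tperm.
Qed.
End ReducedWords.

Section ReducedNormal.
Variables (n : nat) (J : eqType) (e : J -> 'I_n * 'I_n) (gT : finGroupType) (l : J -> gT).
Local Open Scope group_scope.
Variable s : seq J.
Hypothesis (sn : normal (word e l s)).
Local Notation z := (wprod e l s).
Hypothesis (zd : wr_deg z = size s).
Local Notation kappa := (colour (edges e s)).
Local Notation cols := (colours e (nontriv l) kappa s).

Lemma monochromatic_colour : monochromatic e kappa s.
Proof. by apply/allP => k ks; apply/eqP/colour_edge; apply: map_f. Qed.

(** In a component without non-trivial label, the product has a cycle with trivial
cycle-product. There are n - forest_size components, and n - size s cycles with
trivial cycle-product; hence at least size s - forest_size components have a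
non-trivial label. This is the number of edges outside of the forest: each of
them has a non-trivial label, they lie in different components, and there is no
other cycle with trivial cycle-product. *)
Lemma reduced_normal :
  [/\ uniq cols, (forest_size (edges e s) + count (nontriv l) s)%N = size s
    & forall i, class_of (cyc_loop z i) = class_of 1 -> kappa i \notin cols].
Proof.
have sm := monochromatic_colour.
pose rts := [set v | kappa v == v]; pose U := [set v in rts | v \notin cols].
have rtsE : (#|rts| + forest_size (edges e s) = n)%N := card_roots _.
pose b := #|cycles_in z (class_of 1)|.
have bE : (size s + b = n)%N by rewrite -zd wr_deg_triv.
have loop1 i : kappa i \notin cols -> cyc_loop z i = 1.
  move=> ic; have : cycle_product z ((z.2) i) = 1; last by rewrite cycle_product_loop.
  rewrite /cycle_product big1_seq // => v /andP[_].
  rewrite -/(orbit_seq _ _) mem_orbit_seq => /(kappa_porbit sm) kv.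
  by rewrite (wprod_label1 sm) // kv kappa_wprod.
have Uinj : {in U &, injective (porbit z.2)}.
  move=> u v; rewrite !inE => /andP[/eqP <- _] /andP[/eqP <- _] /eqP.
  by rewrite eq_porbit_mem => /(kappa_porbit sm); rewrite !colour_idem.
have Usub : [set porbit z.2 v | v in U] \subset cycles_in z (class_of 1).
  apply/subsetP => _ /imsetP[v vU ->]; rewrite cycles_inE imset_f // cyc_classE.
  by move: vU; rewrite !inE => /andP[/eqP vr vc]; rewrite loop1 ?eqxx // vr.
have Ub : #|U| <= b by rewrite -(card_in_imset Uinj) subset_leq_card.
have sz := forest_size_nontriv sn.
set f := forest_size _ in sz rtsE *; set c := count _ s in sz *.
have cE : size cols = c by rewrite size_map size_filter.
have RU : (#|rts| <= #|U| + size (undup cols))%N.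
  have -> : size (undup cols) = #|[set v in cols]|.
    rewrite cardsE -(card_uniqP (undup_uniq _)).
    by apply: eq_card => v; rewrite mem_undup.
  apply: leq_trans (leq_card_setU _ _); apply: subset_leq_card; apply/subsetP => v vr.
  by move: vr; rewrite !inE => ->; case: (v \in cols).
have und : size (undup cols) <= c by rewrite -cE size_undup.
have [h1 h2 h3] : [/\ size (undup cols) = c, (f + c)%N = size s & #|U| = b] by split; lia.
split=> //; first by rewrite -[uniq _]negbK -ltn_size_undup h1 cE ltnn.
move=> i li; apply/negP => ic.
have/eqP Ueq : [set porbit z.2 v | v in U] == cycles_in z (class_of 1).
  by rewrite eqEcard Usub (card_in_imset Uinj) h3 leqnn.
have : porbit z.2 i \in cycles_in z (class_of 1).
  by rewrite cycles_inE imset_f // cyc_classE li eqxx.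
rewrite -Ueq => /imsetP[v]; rewrite !inE => /andP[/eqP vr vc] /eqP.
rewrite eq_porbit_mem => /(kappa_porbit sm) h; case/negP: vc.
by rewrite -vr -h.
Qed.

End ReducedNormal.

(** * Multiplicative functions of the cycle-products *)

Section CycleScalar.
Variables (n : nat) (gT : finGroupType) (K : comNzRingType).
Variable sc : conj_class gT -> K.
Hypothesis sc1 : sc (class_of 1%g) = 1%R.
Local Open Scope ring_scope.
Implicit Types (x : wreath gT n).

(** The product over the cycles of x of the scalars sc c, c being the class of the
cycle-product. *)
Definition cycle_scalar x : K := \prod_(C in porbits x.2) sc (cyc_class x C).

(** The same product, as a function of the modified type: the cycles with trivial
cycle-product do not contribute. *)
Definition type_scalar (lam : part_fun gT) : K :=
  \prod_(c | c != class_of 1%g) sc c ^+ size (val (lam c)).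

Lemma type_scalarE x : type_scalar (modified_type x) = cycle_scalar x.
Proof.
rewrite /cycle_scalar (partition_big (cyc_class x) predT) //=.
rewrite [RHS](bigD1 (class_of 1%g)) //= [X in _ = X * _]big1 ?mul1r => [|C /andP[_ /eqP ->]] //.
apply: eq_bigr => c c1; rewrite ffunE val_c1 (negPf c1) size_wr_type.
rewrite -prodr_const; apply: eq_big => [C|C]; first by rewrite cycles_inE.
by rewrite cycles_inE => /andP[_ /eqP ->].
Qed.

Variables (J : eqType) (e : J -> 'I_n * 'I_n) (l : J -> gT) (s : seq J).

(** The contribution of one labelled edge to the product of the scalars of all the
labels of a word product. *)
Definition edge_scalar (r : 'I_n * 'I_n * gT) : K :=
  if r.1.1 == r.1.2 then sc (class_of r.2) else sc (class_of r.2) * sc (class_of r.2^-1%g).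

Lemma prod_label_scalar (kappa : 'I_n -> 'I_n) (u : seq J) : monochromatic e kappa u ->
  uniq (colours e (nontriv l) kappa u) ->
  \prod_i sc (class_of ((wprod e l u).1 i)) = \prod_(k <- u) edge_scalar (e k, l k).
Proof.
elim: u => [|k u IH] /=.
  by move=> _ _; rewrite big_nil big1 // => i _; rewrite /wprod /word_prod big_nil ffunE.
move=> /andP[/eqP km um] cu; rewrite big_cons /wprod word_cons.
have um' : uniq (colours e (nontriv l) kappa u).
  by move: cu; rewrite /colours /=; case: ifP => //= _ /andP[].
rewrite -IH // (reindex_inj (@perm_inj _ (tperm (e k).1 (e k).2))).
under eq_bigr do rewrite wrM1 tpermV tpermK /= ffunE /=.
case: (eqVneq (l k) 1%g) => lk.
  rewrite /edge_scalar /= lk invg1 sc1 mul1r if_same mul1r; apply: eq_bigr => i _.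
  by rewrite !if_same mul1g.
have kc : kappa (e k).1 \notin colours e (nontriv l) kappa u.
  by move: cu; rewrite /colours /= /nontriv lk => /= /andP[].
have w1 v : kappa v = kappa (e k).1 -> (wprod e l u).1 v = 1%g.
  by move=> h; apply: (wprod_label1 um); rewrite h.
rewrite /edge_scalar /=; case: (eqVneq (e k).1 (e k).2) => [ab|ab].
  rewrite (bigD1 (e k).1) //= [X in _ = _ * X](bigD1 (e k).1) //=.
  rewrite -ab tperm1 perm1 eqxx w1 // mulg1 sc1 mul1r; congr (_ * _).
  by apply: eq_bigr => i /negPf ik; rewrite perm1 ik mul1g.
rewrite (bigD1 (e k).1) //= (bigD1 (e k).2) 1?eq_sym //=.
rewrite [X in _ = _ * X](bigD1 (e k).1) //= [X in _ = _ * (_ * X)](bigD1 (e k).2) 1?eq_sym //=.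
rewrite tpermL tpermR eqxx eq_sym (negPf ab) !w1 -?km // !mulg1 sc1 !mul1r eqxx.
rewrite mulrCA !mulrA; congr (_ * _).
apply: eq_bigr => i /andP[ia ib]; rewrite tpermD; [|by rewrite eq_sym|by rewrite eq_sym].
by rewrite (negPf ia) (negPf ib) mul1g.
Qed.

Hypotheses (sn : normal (word e l s)).
Hypothesis (zd : wr_deg (wprod e l s) = size s).

(** In a reduced normal word, each cycle of the product goes through at most one
non-trivial label, which is then its cycle-product. *)
Lemma cycle_scalar_word :
  cycle_scalar (wprod e l s) = \prod_(k <- s) edge_scalar (e k, l k).
Proof.
have sm := monochromatic_colour e s; have [su _ cn] := reduced_normal sn zd.
have l1 k : ~~ nontriv l k -> l k = 1%g by rewrite negbK => /eqP.
rewrite -(prod_label_scalar sm su) /cycle_scalar; set z := wprod e l s.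
rewrite [RHS](partition_big (porbit z.2) (mem (porbits z.2))) /=; last first.
  by move=> i _; apply: imset_f.
apply: eq_bigr => _ /imsetP[i _ ->]; rewrite cyc_classE class_cycle_product.
rewrite (cycle_product_total _ sm su).
transitivity (\prod_(v <- orbit_seq z i) sc (class_of (z.1 v))).
  under eq_bigr do rewrite (word_prod_mark _ sm su l1).
  symmetry; apply: (scalar_signed_total l (v0 := i) sm su (f := fun g => sc (class_of g))) => //.
  - exact: orbit_seq_uniq.
  - by move=> v; rewrite mem_orbit_seq; apply: kappa_porbit.
  move=> v; rewrite mem_orbit_seq => vi mv tn.
  have /negP[] : colour (edges e s) i \notin colours e (nontriv l) (colour (edges e s)) s.
    by apply: cn; rewrite class_cycle_product (cycle_product_total _ sm su) tn.
  case E: (mark _ _ _ _) mv => [[b k]|] // _; have [ks fk kv] := markP sm E.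
  by rewrite -(kappa_porbit sm vi) -kv; apply/mapP; exists k; rewrite // mem_filter fk.
rewrite big_uniq ?orbit_seq_uniq //; apply: eq_bigl => v.
by rewrite mem_orbit_seq eq_porbit_mem porbit_sym.
Qed.

End CycleScalar.

(** * Comparison of types for two groups, and invariance under conjugation *)

Section Parallel.
Variables (n : nat) (gT hT : finGroupType) (beta : conj_class gT -> conj_class hT).
Hypothesis beta_inj : injective beta.
Hypothesis beta1 : beta (class_of 1%g) = class_of 1%g.
Local Open Scope group_scope.

(** The relabelling of a type along a map between the sets of classes. *)
Definition pull (lam : part_fun hT) : part_fun gT := [ffun c => lam (beta c)].

Lemma modified_type_pull (x : wreath gT n) (x' : wreath hT n) : x.2 = x'.2 ->
  (forall i, beta (class_of (cyc_loop x i)) = class_of (cyc_loop x' i)) ->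
  modified_type x = pull (modified_type x').
Proof.
move=> x2 H; have cE c : cycles_in x c = cycles_in x' (beta c).
  apply/setP => C; rewrite !cycles_inE x2; apply: andb_id2l => /imsetP[i _ ->].
  by rewrite -{1}x2 !cyc_classE -H (inj_eq beta_inj).
have tE c : wr_type x c = wr_type x' (beta c) by rewrite !ffunE cE.
apply/ffunP => c; rewrite [LHS]ffunE [RHS]ffunE [RHS]ffunE !val_c1 -beta1 (inj_eq beta_inj).
by rewrite -tE.
Qed.

Variables (J : eqType) (e : J -> 'I_n * 'I_n) (l : J -> gT) (l' : J -> hT) (s : seq J).
Hypothesis ll' : forall k, beta (class_of (l k)) = class_of (l' k).
Hypothesis lV : forall k, beta (class_of (l k)^-1) = class_of (l' k)^-1.

Lemma matched_nontriv k : (l k == 1) = (l' k == 1).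
Proof.
by rewrite -!class_of1 !val_c1 -ll' -beta1 (inj_eq beta_inj).
Qed.

(** Two words with the same edges and corresponding labels have products of
corresponding modified types, if the non-trivial labels lie in different
components. *)
Lemma matched_modified_type (kappa : 'I_n -> 'I_n) :
  monochromatic e kappa s -> uniq (colours e (nontriv l) kappa s) ->
  modified_type (wprod e l s) = pull (modified_type (wprod e l' s)).
Proof.
move=> sm su; have fE : nontriv l' = nontriv l.
  by apply/funext => k; rewrite /nontriv matched_nontriv.
have p2 : (wprod e l s).2 = (wprod e l' s).2.
  elim: (s) => [|k u IH]; first by rewrite /wprod /word_prod !big_nil.
  by rewrite /wprod !word_cons !wrM2 IH.
apply: modified_type_pull => // i; rewrite !class_cycle_product.
rewrite (cycle_product_total _ sm su) (cycle_product_total (kappa := kappa) _ sm) ?fE //.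
by rewrite /orbit_seq p2; case: signed_total => [[[] k]|] /=; rewrite ?ll' ?lV ?beta1.
Qed.

End Parallel.

Section ConjType.
Variables (gT : finGroupType) (n : nat).
Local Open Scope group_scope.
Implicit Types (x y z : wreath gT n).

Lemma porbit_conj z x i : porbit (z * x * z^-1).2 (z.2 i) = z.2 @: porbit x.2 i.
Proof.
have E m : ((z * x * z^-1).2 ^+ m) (z.2 i) = z.2 ((x.2 ^+ m) i).
  by rewrite !wrM2 wrV2 -conjgE -conjXg conjgE !permM permK.
apply/setP => v; apply/porbitP/imsetP => [[m ->]|[_ /porbitP[m ->] ->]].
  by exists ((x.2 ^+ m) i); rewrite ?E // mem_porbit.
by exists m; rewrite E.
Qed.

Lemma cyc_loop_conj z x i :
  cyc_loop (z * x * z^-1) (z.2 i) = z.1 (z.2 i) * cyc_loop x i * (z.1 (z.2 i))^-1.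
Proof.
rewrite /cyc_loop porbit_conj card_imset; last exact: perm_inj.
set k := #|_|; have -> : (z * x * z^-1) ^+ k = z * x ^+ k * z^-1.
  elim: k => [|k IH]; first by rewrite !expg0 mulg1 mulgV.
  by rewrite !expgSr IH !mulgA mulgKV.
rewrite !wrM1 wrM2 wrX2 wrV1 invMg permM !permK.
have -> : (x.2 ^+ k)^-1 i = i by apply: (@perm_inj _ (x.2 ^+ k)); rewrite permKV permX_porbit.
by [].
Qed.

Lemma cycles_in_conj z x c :
  cycles_in (z * x * z^-1) c = [set z.2 @: pred_of_set C | C in cycles_in x c].
Proof.
have mem i : (porbit (z * x * z^-1).2 (z.2 i) \in cycles_in (z * x * z^-1) c)
           = (porbit x.2 i \in cycles_in x c).
  by rewrite !cycles_inE !cyc_classE cyc_loop_conj class_ofJ !imset_f.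
apply/setP => C; apply/idP/imsetP => [Cin|[D Din ->]]; last first.
  have := Din; rewrite (cycles_inE x c D) => /andP[/imsetP[i _ Di] _].
  by rewrite {}Di in Din *; rewrite -porbit_conj mem.
have := Cin; rewrite (cycles_inE _ c C) => /andP[/imsetP[i _ Ci] _].
rewrite {}Ci in Cin *.
exists (porbit x.2 (z.2^-1 i)); last by rewrite -porbit_conj permKV.
by rewrite -mem permKV.
Qed.

Lemma intpart_of_perm s t : perm_eq s t -> intpart_of s = intpart_of t.
Proof.
move=> st; apply/val_inj => /=; apply/perm_sortP; last exact: perm_filter.
- by move=> a b; apply: leq_total.
- by move=> a b c ab bc; apply: leq_trans bc ab.
- by move=> a b; rewrite andbC => /anti_leq.
Qed.

Lemma modified_type_conj z x : modified_type (z * x * z^-1) = modified_type x.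
Proof.
suff E c : wr_type (z * x * z^-1) c = wr_type x c.
  by apply/ffunP => c; rewrite [LHS]ffunE [RHS]ffunE E.
rewrite !ffunE; apply: intpart_of_perm; rewrite cycles_in_conj.
set f := fun C : {set 'I_n} => z.2 @: pred_of_set C.
have finj : injective f by apply: imset_inj; apply: perm_inj.
have E : perm_eq (enum [set f C | C in cycles_in x c]) [seq f C | C <- enum (cycles_in x c)].
  apply: uniq_perm; rewrite ?enum_uniq ?(map_inj_uniq finj) ?enum_uniq //.
  move=> C; rewrite mem_enum; apply/imsetP/mapP => -[D];
    by [rewrite -mem_enum => ? ->; exists D | rewrite mem_enum => ? ->; exists D].
apply: perm_trans (perm_map _ E) _; rewrite -map_comp.
rewrite (eq_map (g := fun C => #|pred_of_set C|)) // => C /=.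
by rewrite /f card_imset //; apply: perm_inj.
Qed.

Lemma wr_deg_conj z x : wr_deg (z * x * z^-1) = wr_deg x.
Proof. by rewrite /wr_deg modified_type_conj. Qed.
End ConjType.

(** * Weights of words, and sums over the labels *)

Section ClassScalar.
Variables (gT : finGroupType) (K : numClosedFieldType).
Local Open Scope ring_scope.
Implicit Types (c : conj_class gT) (g : gT).

(** The scalars s_c. The square root comes from a non-trivial label on an edge with
i <> j, which yields two cycles of inverse classes, hence a factor
s_c ^ 2 = #|c| / #|gT|. *)
Definition class_scalar c : K :=
  if c == class_of 1%g then 1 else sqrtC (#|val c|%:R / #|gT|%:R).

Lemma class_scalar1 : class_scalar (class_of 1%g) = 1.
Proof. by rewrite /class_scalar eqxx. Qed.

Lemma order_neq0 : #|gT|%:R != 0 :> K.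
Proof. by rewrite pnatr_eq0 -lt0n; apply/card_gt0P; exists 1%g. Qed.

Lemma conj_class_gt0 c : (0 < #|val c|)%N.
Proof. by have /imsetP[g _ ->] := valP c; apply/card_gt0P; exists g; exact: class_refl. Qed.

Lemma class_scalar_gt0 c : 0 < class_scalar c.
Proof.
rewrite /class_scalar; case: ifP => _; first exact: ltr01.
rewrite sqrtC_gt0 divr_gt0 // ltr0n ?conj_class_gt0 //.
by apply/card_gt0P; exists 1%g.
Qed.

Lemma class_scalar_neq0 c : class_scalar c != 0.
Proof. by rewrite lt0r_neq0 ?class_scalar_gt0. Qed.

Lemma class_scalar_sqr c : c != class_of 1%g -> class_scalar c ^+ 2 = #|val c|%:R / #|gT|%:R.
Proof. by rewrite /class_scalar => /negPf ->; rewrite sqrtCK. Qed.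

Lemma class_ofV g : (val (class_of g))^-1%g = val (class_of g^-1%g).
Proof. by rewrite /= classVg. Qed.

Lemma class_of_eq1 g : (class_of g == class_of 1%g) = (g == 1%g).
Proof. by rewrite -val_c1 class_of1. Qed.

Lemma class_scalarV g : class_scalar (class_of g^-1%g) = class_scalar (class_of g).
Proof. by rewrite /class_scalar !class_of_eq1 invg_eq1 -class_ofV card_invg. Qed.

Lemma type_scalar_neq0 (lam : part_fun gT) : type_scalar class_scalar lam != 0.
Proof. by apply/prodf_neq0 => c _; rewrite expf_neq0 ?class_scalar_neq0. Qed.

End ClassScalar.

Section Weights.
Variables (gT : finGroupType) (n : nat) (K : numClosedFieldType).
Local Open Scope ring_scope.
Local Notation sc := (@class_scalar gT K).
Implicit Types (r : 'I_n * 'I_n * gT).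

(** The weight makes up for an edge with i = j yielding a single cycle, hence a
single factor s_c. *)
Definition edge_weight r : K := if r.1.1 == r.1.2 then (sc (class_of r.2))^-1 else 1.

Lemma edge_weight_gt0 r : 0 < edge_weight r.
Proof. by rewrite /edge_weight; case: ifP; rewrite ?ltr01 ?invr_gt0 ?class_scalar_gt0. Qed.

Lemma edge_weight_scalar r : #|val (class_of r.2)|%:R * edge_weight r =
  (if r.2 != 1%g then #|gT|%:R else 1) * edge_scalar sc r.
Proof.
rewrite /edge_weight /edge_scalar; case: (eqVneq r.2 1%g) => [->|r1] /=.
  by rewrite class1G cards1 !mul1r invg1 class_scalar1 mulr1 invr1 if_same.
have := @class_scalar_sqr gT K (class_of r.2); rewrite class_of_eq1 => /(_ r1) E.
have {}E : #|val (class_of r.2)|%:R = #|gT|%:R * sc (class_of r.2) ^+ 2.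
  by rewrite E mulrCA divff ?order_neq0 ?mulr1.
rewrite [X in X%:R]/= in E; rewrite E class_scalarV.
case: ifP => _; last by rewrite mulr1 expr2.
by rewrite expr2 mulrA mulfK ?class_scalar_neq0.
Qed.

Variables (J : eqType) (e : J -> 'I_n * 'I_n) (l : J -> gT) (s : seq J).

Lemma word_weight_scalar :
  (\prod_(k <- s) #|val (class_of (l k))|%:R) * (\prod_(k <- s) edge_weight (e k, l k)) =
  #|gT|%:R ^+ count (nontriv l) s * \prod_(k <- s) edge_scalar sc (e k, l k) :> K.
Proof.
rewrite -big_split /=; elim: s => [|k u IH]; first by rewrite !big_nil mulr1.
rewrite !big_cons /= IH (edge_weight_scalar (e k, l k)) /= -/(nontriv l k).
rewrite exprD !mulrA; congr (_ * _); rewrite -!mulrA [X in _ * X]mulrC.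
by case: (nontriv l k); rewrite ?mulrA.
Qed.

(** All the numerical factors that depend on the group cancel on a reduced normal
word, except for a power of the order of the group. *)
Lemma reduced_weight : normal (word e l s) -> wr_deg (wprod e l s) = size s ->
  #|gT|%:R ^+ forest_size (edges e s) * (\prod_(k <- s) edge_weight (e k, l k)) *
  (\prod_(k <- s) #|val (class_of (l k))|%:R)
  = #|gT|%:R ^+ size s * type_scalar sc (modified_type (wprod e l s)) :> K.
Proof.
move=> sn sd; have [_ <- _] := reduced_normal sn sd.
rewrite type_scalarE ?class_scalar1 // (cycle_scalar_word (class_scalar1 _ _) sn sd).
by rewrite exprD -!mulrA -word_weight_scalar [X in _ * X]mulrC.
Qed.

End Weights.

Section GaugeSum.
Variables (gT : finGroupType) (n : nat) (K : numFieldType) (J : finType).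
Local Open Scope ring_scope.
Variables (e : J -> 'I_n * 'I_n).
Implicit Types (l : {ffun J -> gT}) (t : {ffun 'I_n -> gT}).

Definition gauge_lab t l : {ffun J -> gT} :=
  [ffun k => t (e k).1 * l k * (t (e k).2)^-1]%g.

Lemma gauge_lab_inj t : injective (gauge_lab t).
Proof.
move=> l l' /ffunP E; apply/ffunP => k; have := E k; rewrite !ffunE.
by move/mulIg/mulgI.
Qed.

Lemma word_gauge t l s : word e (gauge_lab t l) s = [seq gauge t r | r <- word e l s].
Proof. by rewrite /word -map_comp; apply: eq_map => k; rewrite /= /gauge ffunE. Qed.

(** A sum over all the labellings of a gauge-invariant function reduces to the
normal ones. *)
Lemma sum_normal (H : {ffun J -> gT} -> K) s : (forall t l, H (gauge_lab t l) = H l) ->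
  \sum_l H l = #|gT|%:R ^+ forest_size (edges e s) *
              \sum_(l : {ffun J -> gT} | normal (word e l s)) H l.
Proof.
move=> HH.
have q0 : #|gT|%:R != 0 :> K by rewrite pnatr_eq0 -lt0n; apply/card_gt0P; exists 1%g.
apply: (mulfI (expf_neq0 n q0)); rewrite mulrCA.
have -> : #|gT|%:R ^+ n * \sum_(l : {ffun J -> gT} | normal (word e l s)) H l =
  \sum_(t : {ffun 'I_n -> gT}) \sum_(l : {ffun J -> gT} | normal (word e l s)) H l :> K.
  by rewrite sumr_const card_ffun card_ord -[RHS]mulr_natl natrX.
rewrite (eq_bigr (fun t => \sum_(l | normal (word e (gauge_lab t l) s)) H l)); last first.
  move=> t _; rewrite (reindex_inj (@gauge_lab_inj t)) /=.
  by apply: eq_bigr => l _; apply: HH.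
rewrite (exchange_big_dep predT) //= mulr_sumr [RHS]mulr_sumr; apply: eq_bigr => l _.
rewrite sumr_const -[H l *+ _]mulr_natl mulrA -!natrX -natrM.
have := card_gauge (word e l s); rewrite (_ : unzip1 _ = edges e s); last first.
  by rewrite /unzip1 /word -map_comp.
move=> <-; rewrite mulnC; congr (_%:R * _); congr (_ * _)%N.
by apply: eq_card => t; rewrite inE -word_gauge.
Qed.

End GaugeSum.

(** * Transfer of the sums over the labels to another group *)

Section Coupling.
Variables (gT hT : finGroupType) (K : numFieldType) (J : finType).
Local Open Scope ring_scope.
Variable beta : conj_class gT -> conj_class hT.
Hypothesis beta_bij : bijective beta.

Definition class_inv (T : finGroupType) (g : T) : K := #|val (class_of g)|%:R^-1.

(** The uniform probability on each product of corresponding classes; its marginals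
are the uniform probabilities on the classes. *)
Definition coupling (g : gT) (h : hT) : K :=
  if beta (class_of g) == class_of h then class_inv g * class_inv h else 0.

Lemma sum_class_inv (T : finGroupType) (c : conj_class T) :
  \sum_(h | c == class_of h) class_inv h = 1.
Proof.
rewrite (eq_bigr (fun=> #|val c|%:R^-1)) => [|h /eqP ->] //.
rewrite sumr_const (_ : #|_| = #|val c|); last first.
  by apply: eq_card => h; rewrite class_ofP eq_sym.
by rewrite -[LHS]mulr_natr mulVf // pnatr_eq0 -lt0n conj_class_gt0.
Qed.

Lemma coupling_suml g : \sum_h coupling g h = class_inv g.
Proof. by rewrite -big_mkcond -mulr_sumr sum_class_inv mulr1. Qed.

Lemma coupling_sumr h : \sum_g coupling g h = class_inv h.
Proof.
have [gamma betaK gammaK] := beta_bij; rewrite -big_mkcond -mulr_suml.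
rewrite (eq_bigl (fun g => gamma (class_of h) == class_of g)) ?sum_class_inv ?mul1r // => g.
by rewrite -(can_eq gammaK) betaK eq_sym.
Qed.

(** A sum over labellings, averaged over each class, only depends on the classes. *)
Lemma coupled_sum (F : {ffun J -> gT} -> K) (F' : {ffun J -> hT} -> K) :
  (forall (l : {ffun J -> gT}) (l' : {ffun J -> hT}),
     (forall k, beta (class_of (l k)) = class_of (l' k)) -> F l = F' l') ->
  \sum_l F l * \prod_k class_inv (l k) = \sum_l' F' l' * \prod_k class_inv (l' k).
Proof.
move=> FF.
under eq_bigr => l do under eq_bigr => k do rewrite -coupling_suml.
under [RHS]eq_bigr => l do under eq_bigr => k do rewrite -coupling_sumr.
under eq_bigr do rewrite bigA_distr_bigA mulr_sumr.
under [RHS]eq_bigr do rewrite bigA_distr_bigA mulr_sumr.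
rewrite [RHS]exchange_big; apply: eq_bigr => l _; apply: eq_bigr => l' _ /=.
have [/forallP H|/forallPn[k /eqP kn]] :=
    boolP [forall k, beta (class_of (l k)) == class_of (l' k)].
  by rewrite (FF l l') // => k; apply/eqP.
by rewrite (bigD1 k) //= /coupling; case: eqP => // _; rewrite mul0r !mulr0.
Qed.

End Coupling.

Section KeySum.
Variables (n : nat) (K : numClosedFieldType) (J : finType) (e : J -> 'I_n * 'I_n).
Variables (s1 s2 : seq J).
Hypothesis s_enum : perm_eq (s1 ++ s2) (enum J).
Local Open Scope ring_scope.
Local Notation s := (s1 ++ s2).

Lemma prod_index (f : J -> K) : \prod_(k <- s) f k = \prod_k f k.
Proof. by rewrite (perm_big _ s_enum) big_enum. Qed.

Section OneGroup.
Variables (gT : finGroupType) (F : part_fun gT -> part_fun gT -> part_fun gT -> K).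
Local Notation sc := (@class_scalar gT K).
Local Notation mt u l := (modified_type (wprod e l u)).

(** The weighted sum, over the labellings whose word s1 ++ s2 is reduced, of a
function of the modified types of the products of s1, of s2 and of the whole
word, divided by the scalars of the cycles of the latter. *)
Definition label_sum : K := \sum_(l : {ffun J -> gT})
  (\prod_k edge_weight K (e k, l k)) *
  (if wr_deg (wprod e l s) == size s
   then F (mt s1 l) (mt s2 l) (mt s l) / type_scalar sc (mt s l) else 0).

(** What is left of a term of [label_sum] once the weights are simplified. *)
Definition normal_term (l : {ffun J -> gT}) : K :=
  if normal (word e l s) && (wr_deg (wprod e l s) == size s)
  then F (mt s1 l) (mt s2 l) (mt s l) else 0.

Definition gauge_elt (t : {ffun 'I_n -> gT}) : wreath gT n := (t, 1%g).

Lemma wprod_gauge t (l : {ffun J -> gT}) u :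
  wprod e (gauge_lab e t l) u = (gauge_elt t * wprod e l u * (gauge_elt t)^-1)%g.
Proof.
rewrite /wprod word_gauge; elim: u => [|k u IH] /=.
  by rewrite /word_prod big_nil mulg1 mulgV.
rewrite !word_prod_cons IH !mulgA; congr (_ * _ * _)%g.
rewrite -[RHS](mulgKV (gauge_elt t)); congr (_ * _)%g.
by rewrite refl_conj /= !perm1.
Qed.

Lemma label_sum_normal :
  label_sum = #|gT|%:R ^+ size s *
    \sum_(l : {ffun J -> gT}) normal_term l * \prod_k class_inv K (l k).
Proof.
rewrite /label_sum (@sum_normal gT n K J e _ s) => [|t l]; last first.
  rewrite !wprod_gauge wr_deg_conj !modified_type_conj; congr (_ * _).
  apply: eq_bigr => k _; rewrite /edge_weight /= ffunE; case: eqP => // ->.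
  by rewrite class_ofJ.
rewrite big_mkcond !mulr_sumr; apply: eq_bigr => l _; rewrite /normal_term.
case sn: (normal _); last by rewrite mul0r !mulr0.
case: eqP => sd /=; last by rewrite mul0r !mulr0.
have := reduced_weight K sn sd; rewrite !prod_index => E.
set cI := \prod_k class_inv _ _; pose cl : K := \prod_k #|val (class_of (l k))|%:R.
have cl0 : cl != 0 by apply/prodf_neq0 => k _; rewrite pnatr_eq0 -lt0n conj_class_gt0.
have cIE : cI = cl^-1 by rewrite /cI /class_inv prodfV.
have S0 := type_scalar_neq0 K (mt s l).
set S := type_scalar _ _ in E S0 *; set Fl := F _ _ _; rewrite cIE [LHS]mulrA.
have -> : #|gT|%:R ^+ forest_size (edges e s) * \prod_k edge_weight K (e k, l k)
    = #|gT|%:R ^+ size s * S / cl by rewrite -E mulfK.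
by field; rewrite S0 cl0.
Qed.

End OneGroup.
End KeySum.

Section TwoGroups.
Variables (gT hT : finGroupType) (beta : conj_class gT -> conj_class hT).
Hypothesis beta_bij : bijective beta.
Hypothesis beta1 : beta (class_of 1%g) = class_of 1%g.
Hypothesis betaV : forall g h, beta (class_of g) = class_of h ->
  beta (class_of g^-1%g) = class_of h^-1%g.
Variables (n : nat) (K : numClosedFieldType).
Local Open Scope ring_scope.

Lemma pf_norm_pull lam : pf_norm (pull beta lam) = pf_norm lam.
Proof.
rewrite /pf_norm [RHS](reindex beta) /=; last exact: onW_bij.
by apply: eq_bigr => c _; rewrite ffunE.
Qed.

Variable F : part_fun gT -> part_fun gT -> part_fun gT -> K.

(** A function of three types for gT, seen as a function of types for hT. *)
Definition pull3 (a b c : part_fun hT) := F (pull beta a) (pull beta b) (pull beta c).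

Section Edges.
Variables (J : finType) (e : J -> 'I_n * 'I_n) (s1 s2 : seq J).
Hypothesis s_enum : perm_eq (s1 ++ s2) (enum J).
Local Notation s := (s1 ++ s2).

Lemma normal_nontriv (l : J -> gT) (l' : J -> hT) u : nontriv l =1 nontriv l' ->
  normal (word e l u) = normal (word e l' u).
Proof.
move=> E; elim: u => //= k u ->; congr (_ && _).
have -> : unzip1 (word e l u) = unzip1 (word e l' u) by rewrite /unzip1 -!map_comp.
by congr (_ ==> _); apply: negb_inj; apply: E.
Qed.

Lemma normal_term_matched (l : {ffun J -> gT}) (l' : {ffun J -> hT}) :
  (forall k, beta (class_of (l k)) = class_of (l' k)) ->
  normal_term e s1 s2 F l = normal_term e s1 s2 pull3 l'.
Proof.
move=> ll'; have beta_inj := bij_inj beta_bij.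
have lV k : beta (class_of (l k)^-1%g) = class_of (l' k)^-1%g by apply: betaV.
have nt : nontriv l = nontriv l'.
  by apply/funext => k; rewrite /nontriv (matched_nontriv beta_inj beta1 ll').
rewrite /normal_term (normal_nontriv _ (l' := l')) ?nt //.
case sn': (normal _) => //=.
have sn : normal (word e l s) by rewrite (normal_nontriv _ (l' := l')) ?nt.
have sm := monochromatic_colour e s.
have sub (u : seq J) : subseq u s ->
    uniq (colours e (nontriv l) (colour (edges e s)) s) ->
    modified_type (wprod e l u) = pull beta (modified_type (wprod e l' u)).
  move=> uss su.
  apply: (matched_modified_type beta_inj beta1 ll' lV (kappa := colour (edges e s))).
    by apply/allP => k /(mem_subseq uss); apply: (allP sm).
  apply: subseq_uniq su; apply: map_subseq.
  by rewrite subseq_filter filter_all (subseq_trans (filter_subseq _ _) uss).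
have deq : uniq (colours e (nontriv l) (colour (edges e s)) s) ->
    wr_deg (wprod e l s) = wr_deg (wprod e l' s).
  by move=> su; rewrite /wr_deg sub ?pf_norm_pull.
have [sd|] := eqVneq (wr_deg (wprod e l s)) (size s).
  have [su _ _] := reduced_normal sn sd.
  rewrite -deq // sd eqxx /pull3 -!sub //; first exact: suffix_subseq.
  exact: prefix_subseq.
move=> /eqP h; case: eqP => // sd'; case: h; rewrite deq //.
by have [] := reduced_normal sn' sd'; rewrite nt.
Qed.

Lemma label_sum_eq :
  label_sum e s1 s2 F / #|gT|%:R ^+ size s = label_sum e s1 s2 pull3 / #|hT|%:R ^+ size s.
Proof.
rewrite !label_sum_normal // mulrAC mulfV ?mul1r; last by rewrite expf_neq0 ?order_neq0.
rewrite [RHS]mulrAC mulfV ?mul1r; last by rewrite expf_neq0 ?order_neq0.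
exact: (coupled_sum beta_bij) normal_term_matched.
Qed.
End Edges.
End TwoGroups.

(** * Sums over words *)

Section SplitFun.
Variables (p q : nat) (T : finType) (K : nmodType).
Local Open Scope ring_scope.

Definition ffjoin (u : {ffun 'I_p -> T}) (v : {ffun 'I_q -> T}) : {ffun 'I_(p + q) -> T} :=
  [ffun k => match split k with inl i => u i | inr j => v j end].

Lemma ffjoinl u v i : ffjoin u v (lshift q i) = u i.
Proof. by rewrite ffunE (unsplitK (inl i)). Qed.

Lemma ffjoinr u v j : ffjoin u v (rshift p j) = v j.
Proof. by rewrite ffunE (unsplitK (inr j)). Qed.

Lemma sum_ffjoin (F : {ffun 'I_(p + q) -> T} -> K) :
  \sum_f F f = \sum_u \sum_v F (ffjoin u v).
Proof.
rewrite pair_big (reindex (fun uv => ffjoin uv.1 uv.2)) //=.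
exists (fun f : {ffun 'I_(p + q) -> T} =>
    ([ffun i => f (lshift q i)], [ffun j => f (rshift p j)])).
  move=> [u v] _; congr pair; apply/ffunP => i; rewrite !ffunE.
    by rewrite (unsplitK (inl i)).
  by rewrite (unsplitK (inr i)).
move=> f _; apply/ffunP => k; rewrite ffunE.
by case: split_ordP => j ->; rewrite ffunE.
Qed.
End SplitFun.

Lemma enum_ord_split p q :
  enum 'I_(p + q) = [seq lshift q i | i <- enum 'I_p] ++ [seq rshift p j | j <- enum 'I_q].
Proof.
apply: (inj_map val_inj).
rewrite val_enum_ord map_cat -(map_comp _ (lshift q)) -(map_comp _ (@rshift p q)) iotaD.
congr (_ ++ _); first by rewrite -val_enum_ord; apply: eq_map.
by rewrite add0n -[X in iota X _]addn0 iotaDl -val_enum_ord -(map_comp _ val); apply: eq_map.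
Qed.

Section WordWeight.
Variables (gT : finGroupType) (n : nat) (K : numClosedFieldType).
Local Open Scope ring_scope.
Local Notation edge := ('I_n * 'I_n)%type.
Local Notation ew e l k := (edge_weight K (e k, l k)).
Implicit Types (x y : wreath gT n).

(** The total weight of the words of length d with product x, a word being given by
its edges and its labels. *)
Definition word_weight d x : K :=
  \sum_(e : {ffun 'I_d -> edge}) \sum_(l : {ffun 'I_d -> gT} | wprod e l (enum 'I_d) == x)
    \prod_k ew e l k.

Lemma sum_word_weight d (G : wreath gT n -> K) :
  \sum_x word_weight d x * G x =
  \sum_(e : {ffun 'I_d -> edge}) \sum_(l : {ffun 'I_d -> gT})
    (\prod_k ew e l k) * G (wprod e l (enum 'I_d)).
Proof.
under eq_bigr do rewrite mulr_suml; rewrite exchange_big /=; apply: eq_bigr => e _.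
under eq_bigr do rewrite mulr_suml.
rewrite (exchange_big_dep predT) //=; apply: eq_bigr => l _.
by rewrite (big_pred1 (wprod e l (enum 'I_d))) // => x; rewrite eq_sym.
Qed.

Variables p q : nat.
Local Notation s1 := [seq lshift q i | i <- enum 'I_p].
Local Notation s2 := [seq rshift p j | j <- enum 'I_q].

Lemma sum_word_split (H : wreath gT n -> wreath gT n -> K) :
  \sum_(e : {ffun 'I_(p + q) -> edge}) \sum_(l : {ffun 'I_(p + q) -> gT})
    (\prod_k ew e l k) * H (wprod e l s1) (wprod e l s2) =
  \sum_x \sum_y word_weight p x * word_weight q y * H x y.
Proof.
transitivity (\sum_x word_weight p x * \sum_y word_weight q y * H x y); last first.
  by apply: eq_bigr => x _; rewrite mulr_sumr; apply: eq_bigr => y _; rewrite mulrA.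
rewrite sum_word_weight sum_ffjoin; apply: eq_bigr => e1 _.
transitivity (\sum_e2 \sum_l1 \sum_l2 (\prod_k ew (ffjoin e1 e2) (ffjoin l1 l2) k) *
  H (wprod (ffjoin e1 e2) (ffjoin l1 l2) s1) (wprod (ffjoin e1 e2) (ffjoin l1 l2) s2)).
  by apply: eq_bigr => e2 _; rewrite sum_ffjoin.
rewrite exchange_big /=; apply: eq_bigr => l1 _.
rewrite sum_word_weight mulr_sumr; apply: eq_bigr => e2 _.
rewrite mulr_sumr; apply: eq_bigr => l2 _; rewrite mulrA big_split_ord /=.
congr (_ * _ * H _ _).
- by apply: eq_bigr => k _; rewrite !ffjoinl.
- by apply: eq_bigr => k _; rewrite !ffjoinr.
- rewrite /wprod /word -map_comp; congr word_prod; apply: eq_map => k /=.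
  by rewrite !ffjoinl.
- rewrite /wprod /word -map_comp; congr word_prod; apply: eq_map => k /=.
  by rewrite !ffjoinr.
Qed.

Lemma wprod_cat (J : eqType) (e : J -> edge) (l : J -> gT) t1 t2 :
  wprod e l (t1 ++ t2) = (wprod e l t1 * wprod e l t2)%g.
Proof. by rewrite /wprod /word map_cat /word_prod big_cat. Qed.

Lemma sum_label_sum F :
  \sum_(e : {ffun 'I_(p + q) -> edge}) label_sum e s1 s2 F =
  \sum_x \sum_y word_weight p x * word_weight q y *
    (if wr_deg (x * y)%g == (p + q)%N
     then F (modified_type x) (modified_type y) (modified_type (x * y)%g)
          / type_scalar (@class_scalar gT K) (modified_type (x * y)%g) else 0).
Proof.
rewrite -sum_word_split; apply: eq_bigr => e _; apply: eq_bigr => l _.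
by rewrite wprod_cat size_cat (size_map (lshift q)) (size_map (@rshift p q)) !size_enum_ord.
Qed.

Definition conj_edge (z : wreath gT n) (r : edge) : edge := (z.2 r.1, z.2 r.2).

Lemma word_prod_conj z (w : seq (edge * gT)) :
  (z * word_prod w * z^-1)%g = word_prod [seq (conj_edge z r.1,
    (z.1 (z.2 r.1.1) * r.2 * (z.1 (z.2 r.1.2))^-1)%g) | r <- w].
Proof.
elim: w => [|r w IH] /=; first by rewrite /word_prod big_nil mulg1 mulgV.
by rewrite !word_prod_cons -IH -refl_conj !mulgA mulgKV.
Qed.

Lemma word_weight_conj d z x : word_weight d (z * x * z^-1)%g = word_weight d x.
Proof.
have cinj : injective (conj_edge z) by move=> [i j] [i' j'] [] /perm_inj -> /perm_inj ->.
pose Ce (e : {ffun 'I_d -> edge}) : {ffun 'I_d -> edge} := [ffun k => conj_edge z (e k)].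
pose Cl (e : {ffun 'I_d -> edge}) (l : {ffun 'I_d -> gT}) : {ffun 'I_d -> gT} :=
  [ffun k => z.1 (z.2 (e k).1) * l k * (z.1 (z.2 (e k).2))^-1]%g.
have Ce_inj : injective Ce.
  by move=> e e' /ffunP E; apply/ffunP => k; have := E k; rewrite !ffunE => /cinj.
have Cl_inj e : injective (Cl e).
  move=> l l' /ffunP E; apply/ffunP => k; have := E k; rewrite !ffunE.
  by move/mulIg/mulgI.
rewrite [LHS](reindex_inj Ce_inj) /=; apply: eq_bigr => e _.
rewrite [LHS](reindex_inj (Cl_inj e)) /=; apply: eq_big => [l|l _].
  rewrite -[RHS](inj_eq (mulgI z)) -[RHS](inj_eq (mulIg z^-1%g)); congr (_ == _).
  rewrite /wprod word_prod_conj; congr word_prod; rewrite /word.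
  by elim: (enum _) => //= k u ->; rewrite !ffunE.
apply: eq_bigr => k _; rewrite /edge_weight !ffunE /= (inj_eq perm_inj).
by case: eqP => // ->; rewrite class_ofJ.
Qed.

Lemma word_weight_gt0 x : 0 < word_weight (wr_deg x) x.
Proof.
have [w sw wE] := reduced_word x; rewrite -sw.
pose e := [ffun k => (tnth (in_tuple w) k).1]; pose l := [ffun k => (tnth (in_tuple w) k).2].
have el : wprod e l (enum 'I_(size w)) = x.
  rewrite -[RHS]wE /wprod; congr word_prod; rewrite -[RHS](map_tnth_enum (in_tuple w)).
  by apply: eq_map => k; rewrite !ffunE -surjective_pairing.
have pos (e' : {ffun 'I_(size w) -> edge}) (l' : {ffun 'I_(size w) -> gT}) :
    0 < \prod_k ew e' l' k.
  by apply: prodr_gt0 => k _; apply: edge_weight_gt0.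
rewrite /word_weight (bigD1 e) //= ltr_pwDl //.
  rewrite (bigD1 l) /=; last by rewrite el.
  by rewrite ltr_pwDl ?sumr_ge0 // => l' _; apply: ltW.
by apply: sumr_ge0 => e' _; apply: sumr_ge0 => l' _; apply: ltW.
Qed.

End WordWeight.

(** * The graded convolution of class functions *)

Section Convolution.
Variables (gT : finGroupType) (n : nat) (K : numClosedFieldType).
Local Open Scope ring_scope.
Implicit Types (x y z : wreath gT n) (u v : wreath gT n -> K).

Definition class_fun u := forall x y, modified_type x = modified_type y -> u x = u y.

(** The product of the graded ring in terms of the values: only the additive
factorizations of z contribute. *)
Definition graded_conv u v z : K :=
  \sum_(x | (wr_deg x + wr_deg (x^-1 * z)%g == wr_deg z)%N) u x * v (x^-1 * z)%g.

(** The total weight of the reduced words for x. *)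
Definition total_weight x : K := word_weight K (wr_deg x) x.

Lemma total_weight_neq0 x : total_weight x != 0.
Proof. by rewrite lt0r_neq0 ?word_weight_gt0. Qed.

Lemma class_fun_conj u : (forall z x, u (z * x * z^-1)%g = u x) -> class_fun u.
Proof. by move=> uc x y /wr_conj[z ->]; rewrite uc. Qed.

Lemma class_fun_weight : class_fun total_weight.
Proof. by apply: class_fun_conj => z x; rewrite /total_weight wr_deg_conj word_weight_conj. Qed.

Lemma class_funJ u z x : class_fun u -> u (z * x * z^-1)%g = u x.
Proof. by apply; apply: modified_type_conj. Qed.

Lemma class_fun_graded_conv u v : class_fun u -> class_fun v -> class_fun (graded_conv u v).
Proof.
move=> cu cv; apply: class_fun_conj => w z; rewrite /graded_conv.
have inj : injective (fun x => w * x * w^-1)%g by move=> x y /mulIg/mulgI.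
rewrite (reindex_inj inj) /=.
have E x : ((w * x * w^-1)^-1 * (w * z * w^-1) = w * (x^-1 * z) * w^-1)%g.
  by rewrite !invMg invgK !mulgA mulgKV.
by apply: eq_big => [x|x _]; rewrite E ?wr_deg_conj // !class_funJ.
Qed.

Lemma sum_class_fun u x0 : class_fun u ->
  \sum_(z | modified_type z == modified_type x0) u z
  = #|[set z : wreath gT n | modified_type z == modified_type x0]|%:R * u x0.
Proof.
move=> cu; rewrite (eq_bigr (fun=> u x0)) => [|z /eqP/cu //].
by rewrite sumr_const -[LHS]mulr_natl; congr (_%:R * _); apply: eq_card => z; rewrite inE.
Qed.

(** The value u x / total_weight x as a function of the type of x, and 0 for the
types that do not occur. *)
Definition type_val u (a : part_fun gT) : K :=
  if [pick x : wreath gT n | modified_type x == a] is Some x then u x / total_weight x else 0.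

Lemma type_valE u x : class_fun u -> type_val u (modified_type x) = u x / total_weight x.
Proof.
move=> cu; rewrite /type_val; case: pickP => [y /eqP E|/(_ x)]; last by rewrite eqxx.
by rewrite (cu _ _ E) (class_fun_weight E).
Qed.

(** The sum of [sum_label_sum]: words of length p + q, grouped by the products x and
y of their first p and last q letters. *)
Definition pair_term (F : part_fun gT -> part_fun gT -> part_fun gT -> K) p q : K :=
  \sum_(x : wreath gT n) \sum_(y : wreath gT n) word_weight K p x * word_weight K q y *
    (if wr_deg (x * y)%g == (p + q)%N
     then F (modified_type x) (modified_type y) (modified_type (x * y)%g)
          / type_scalar (@class_scalar gT K) (modified_type (x * y)%g) else 0).

(** The function of three types that extracts from [pair_term] the part of the graded
convolution with factors of degrees p and q, at elements of type c0. *)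
Definition graded_kernel u v (c0 : part_fun gT) p q a b c : K :=
  if [&& pf_norm a == p, pf_norm b == q & c == c0] then type_val u a * type_val v b else 0.

Lemma pair_term_graded_conv u v x0 : class_fun u -> class_fun v ->
  \sum_(p < (wr_deg x0).+1)
     pair_term (graded_kernel u v (modified_type x0) p (wr_deg x0 - p)%N) p (wr_deg x0 - p)%N
  = (\sum_(z | modified_type z == modified_type x0) graded_conv u v z)
    / type_scalar (@class_scalar gT K) (modified_type x0).
Proof.
move=> cu cv; set d := wr_deg x0; set S := type_scalar _ _.
transitivity (\sum_(p < d.+1) \sum_(x : wreath gT n) \sum_(z : wreath gT n)
   if [&& wr_deg x == p, wr_deg (x^-1 * z)%g == (d - p)%N & modified_type z == modified_type x0]
   then u x * v (x^-1 * z)%g / S else 0).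
  apply: eq_bigr => p _; apply: eq_bigr => x _.
  rewrite (reindex_inj (mulgI x^-1%g)) /=; apply: eq_bigr => z _.
  have pd : (p <= d)%N by rewrite -ltnS.
  rewrite mulKVg (subnKC pd) /graded_kernel.
  rewrite -[pf_norm (modified_type x)]/(wr_deg x).
  rewrite -[pf_norm (modified_type (x^-1 * z)%g)]/(wr_deg (x^-1 * z)%g).
  case: and3P => [[/eqP xp /eqP yq /eqP zE]|_]; last by rewrite mul0r if_same mulr0.
  have -> : wr_deg z == d by rewrite /d /wr_deg zE.
  rewrite -yq -xp -/(total_weight x) -/(total_weight _) zE -/S !type_valE //.
  have S0 : S != 0 := type_scalar_neq0 _ _.
  have := total_weight_neq0 x; have := total_weight_neq0 (x^-1 * z)%g.
  set Rx := total_weight x; set Ry := total_weight _ => Ry0 Rx0.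
  by field; rewrite S0 Rx0 Ry0.
rewrite exchange_big mulr_suml /=.
under eq_bigr do rewrite exchange_big /=.
rewrite exchange_big /= [RHS]big_mkcond; apply: eq_bigr => z _.
have [zE|_] := eqVneq; last first.
  by apply: big1 => x _; apply: big1 => p _; rewrite !andbF.
have dz : wr_deg z = d by rewrite /d /wr_deg zE.
rewrite /graded_conv mulr_suml [RHS]big_mkcond; apply: eq_bigr => x _.
rewrite dz; case: eqP => [xz|xz].
  have xd : (wr_deg x < d.+1)%N by rewrite ltnS -xz leq_addr.
  have dx : (d - wr_deg x)%N = wr_deg (x^-1 * z)%g by rewrite -xz addKn.
  rewrite (bigD1 (Ordinal xd)) //= dx !eqxx /= big1 ?addr0 // => p.
  by rewrite -val_eqE /= eq_sym => /negPf ->.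
apply: big1 => p _; case: and3P => // -[/eqP h1 /eqP h2 _]; case: xz.
by rewrite h1 h2 subnKC // -ltnS.
Qed.

Lemma sum_word_weight0 (G : wreath gT n -> K) : \sum_y word_weight K 0 y * G y = G 1%g.
Proof.
rewrite sum_word_weight.
rewrite (eq_bigr (fun=> G 1%g)) => [|e _]; first by rewrite sumr_const card_ffun card_ord expn0.
rewrite (eq_bigr (fun=> G 1%g)) => [|l _]; first by rewrite sumr_const card_ffun card_ord expn0.
rewrite big_ord0 mul1r; congr G; rewrite /wprod /word.
by case: (enum _) => [|[]] //; rewrite /word_prod big_nil.
Qed.

(** Cutting a word at its end (q = 0) counts the reduced words themselves. *)
Lemma pair_term_weight x0 (d := wr_deg x0) :
  pair_term (fun _ _ c => (c == modified_type x0)%:R) d 0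
  = (\sum_(z | modified_type z == modified_type x0) total_weight z)
    / type_scalar (@class_scalar gT K) (modified_type x0).
Proof.
rewrite mulr_suml [RHS]big_mkcond; apply: eq_bigr => x _.
under eq_bigr do rewrite -mulrA mulrCA.
rewrite sum_word_weight0 mulg1 addn0.
case: (modified_type x =P _) => [xE|_]; last by rewrite mul0r if_same mulr0.
have xd : wr_deg x = d by rewrite /d /wr_deg xE.
by rewrite xd eqxx mul1r /total_weight xd xE.
Qed.

End Convolution.

Section Transfer.
Variables (gT hT : finGroupType) (beta : conj_class gT -> conj_class hT).
Hypothesis beta_bij : bijective beta.
Hypothesis beta1 : beta (class_of 1%g) = class_of 1%g.
Hypothesis betaV : forall g h, beta (class_of g) = class_of h ->
  beta (class_of g^-1%g) = class_of h^-1%g.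
Variables (n : nat) (K : numClosedFieldType).
Local Open Scope ring_scope.

Lemma pair_term_transfer F p q :
  pair_term (gT := gT) n (K := K) F p q / #|gT|%:R ^+ (p + q) =
  pair_term n (pull3 beta F) p q / #|hT|%:R ^+ (p + q).
Proof.
rewrite /pair_term -!sum_label_sum !mulr_suml; apply: eq_bigr => e _.
have := @label_sum_eq _ _ _ beta_bij beta1 betaV n K F _ e [seq lshift q i | i <- enum 'I_p]
  [seq rshift p j | j <- enum 'I_q].
rewrite -enum_ord_split size_enum_ord; exact.
Qed.

(** The correspondence between class functions for the two groups. *)
Definition corresponds (u : wreath gT n -> K) (u' : wreath hT n -> K) :=
  forall x x', modified_type x = pull beta (modified_type x') ->
    u x / total_weight K x = u' x' / total_weight K x'.

Lemma pull_inj : injective (pull beta).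
Proof.
have [gamma _ gammaK] := beta_bij.
by move=> a b /ffunP E; apply/ffunP => c; have := E (gamma c); rewrite !ffunE gammaK.
Qed.

(** The element x has the permutation of x', and one label on each cycle, at its
chosen representative. *)
Lemma realization (x' : wreath hT n) :
  exists x : wreath gT n, modified_type x = pull beta (modified_type x').
Proof.
have [gamma betaK gammaK] := beta_bij.
have rep (c : conj_class gT) : exists g, class_of g == c.
  have /card_gt0P[g gc] := conj_class_gt0 c; exists g; by rewrite -class_ofP.
pose lb i := xchoose (rep (gamma (class_of (cyc_loop x' i)))).
have lbE i : beta (class_of (lb i)) = class_of (cyc_loop x' i).
  by rewrite (eqP (xchooseP (rep _))) gammaK.
pose x : wreath gT n := ([ffun i => if cyc_rep x'.2 i == i then lb i else 1%g], x'.2).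
exists x; apply: (modified_type_pull (bij_inj beta_bij) beta1) => // i.
have rp : cyc_rep x'.2 i \in porbit x'.2 i := cyc_rep_porbit _ _.
rewrite -(cyc_loop_class_porbit rp) -lbE class_cycle_product; congr (beta (class_of _)).
rewrite /cycle_product -/(orbit_seq x i).
rewrite (eq_big_seq (fun j => if j == cyc_rep x'.2 i then lb (cyc_rep x'.2 i) else 1%g)).
  have := orbit_seq_uniq x i; have := rp; rewrite -[porbit _ _]/(porbit x.2 i) -mem_orbit_seq.
  elim: (orbit_seq x i) => //= j t IH; rewrite inE big_cons eq_sym => /orP[/eqP->|jt] /andP[jn ut].
    rewrite eqxx big1_seq ?mulg1 // => k /andP[_ kt]; case: eqP => // kj.
    by rewrite -kj kt in jn.
  case: eqP => [ji|_]; first by rewrite ji jt in jn.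
  by rewrite mul1g IH.
move=> j; rewrite mem_orbit_seq ffunE => ji.
have -> : cyc_rep x'.2 j = cyc_rep x'.2 i by apply: eq_cyc_rep; apply/eqP; rewrite eq_porbit_mem.
by rewrite eq_sym; case: eqP => // ->.
Qed.

(** Correspondence follows from the equality of the normalized sums over the elements
of a given type: dividing by the same sums for [total_weight] removes the
normalizations and the numbers of elements. *)
Lemma corresponds_class_sum (u : wreath gT n -> K) (u' : wreath hT n -> K) x0 x0' :
  class_fun u -> class_fun u' -> modified_type x0 = pull beta (modified_type x0') ->
  (\sum_(z | modified_type z == modified_type x0) u z)
    / type_scalar (@class_scalar gT K) (modified_type x0) / #|gT|%:R ^+ wr_deg x0
  = (\sum_(z | modified_type z == modified_type x0') u' z)
    / type_scalar (@class_scalar hT K) (modified_type x0') / #|hT|%:R ^+ wr_deg x0 ->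
  u x0 / total_weight K x0 = u' x0' / total_weight K x0'.
Proof.
move=> cu cu' E.
have dE : wr_deg x0' = wr_deg x0 by rewrite /wr_deg E (pf_norm_pull beta_bij).
have := pair_term_transfer (fun _ _ c => (c == modified_type x0)%:R) (wr_deg x0) 0.
rewrite pair_term_weight addn0.
have -> : pull3 beta (fun _ _ c => (c == modified_type x0)%:R)
    = (fun _ _ c => (c == modified_type x0')%:R) :> (_ -> _ -> _ -> K).
  by apply/funext => a; apply/funext => b; apply/funext => c; rewrite /pull3 E (inj_eq pull_inj).
rewrite -dE pair_term_weight !sum_class_fun //; try exact: class_fun_weight.
set S := type_scalar _ _; set S' := type_scalar _ _.
set N : K := #|[set z : wreath gT n | modified_type z == modified_type x0]|%:R.
set N' : K := #|[set z : wreath hT n | modified_type z == modified_type x0']|%:R.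
have N0 : N != 0 by rewrite pnatr_eq0 -lt0n; apply/card_gt0P; exists x0; rewrite inE.
have N0' : N' != 0 by rewrite pnatr_eq0 -lt0n; apply/card_gt0P; exists x0'; rewrite inE.
have S0 : S != 0 := type_scalar_neq0 _ _.
have S0' : S' != 0 := type_scalar_neq0 _ _.
have q0 : #|gT|%:R ^+ wr_deg x0' != 0 :> K by rewrite expf_neq0 ?order_neq0.
have q0' : #|hT|%:R ^+ wr_deg x0' != 0 :> K by rewrite expf_neq0 ?order_neq0.
have R0 := total_weight_neq0 K x0; have R0' := total_weight_neq0 K x0'.
set q := _ ^+ _ in q0 *; set q' := _ ^+ _ in q0' *.
have quo (a b c d f : K) : c != 0 -> d != 0 -> f != 0 -> b != 0 ->
    a / b = (c * a / d / f) / (c * b / d / f).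
  by move=> c0 d0 f0 b0; field; rewrite c0 d0 f0 b0.
by move=> E1 E2; rewrite [LHS](quo _ _ N S q) // [RHS](quo _ _ N' S' q') // E1 E2.
Qed.

Lemma graded_conv_corresponds u v u' v' :
  class_fun u -> class_fun v -> class_fun u' -> class_fun v' ->
  corresponds u u' -> corresponds v v' ->
  corresponds (graded_conv u v) (graded_conv u' v').
Proof.
move=> cu cv cu' cv' uu vv x0 x0' E.
apply: corresponds_class_sum => //; try exact: class_fun_graded_conv.
have dE : wr_deg x0' = wr_deg x0 by rewrite /wr_deg E (pf_norm_pull beta_bij).
rewrite -!pair_term_graded_conv // -dE !mulr_suml dE; apply: eq_bigr => p _.
have dp : (p + (wr_deg x0 - p))%N = wr_deg x0 by rewrite subnKC // -ltnS.
have tv (w : wreath gT n -> K) w' : class_fun w -> class_fun w' -> corresponds w w' ->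
    forall x' : wreath hT n,
      type_val w (pull beta (modified_type x')) = type_val w' (modified_type x').
  by move=> cw cw' ww x'; have [x xE] := realization x'; rewrite -xE !type_valE //; apply: ww.
have := pair_term_transfer
  (graded_kernel u v (modified_type x0) p (wr_deg x0 - p)%N) p (wr_deg x0 - p)%N.
rewrite dp => ->; congr (_ / _).
apply: eq_bigr => x _; apply: eq_bigr => y _; congr (_ * _); case: ifP => // _; congr (_ / _).
rewrite E /pull3 /graded_kernel !(pf_norm_pull beta_bij) (tv u u' cu cu' uu) (tv v v' cv cv' vv).
by rewrite (inj_eq pull_inj).
Qed.
End Transfer.

(** * Values of the elements of the graded ring *)

Section GradedPi.
Variables (A : comNzRingType) (F : filtration A).
Local Open Scope ring_scope.
Local Open Scope quotient_scope.
Local Notation Q := {ideal_quot (@rees_ideal A F)}.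

(** The canonical projection of the Rees ring onto the associated graded ring. *)
Definition graded_pi (p : rees_ring F) : assoc_graded F := (\pi_Q p : Q).

Lemma graded_piP (a : assoc_graded F) : exists p, a = graded_pi p.
Proof. by exists (generic_quotient.repr (a : Q)); rewrite /graded_pi reprK. Qed.

Lemma graded_pi1 : graded_pi 1 = 1.
Proof. exact: (rmorph1 (\pi_Q : {rmorphism _ -> Q})). Qed.

Lemma graded_piM p q : graded_pi (p * q) = graded_pi p * graded_pi q.
Proof. exact: (rmorphM (\pi_Q : {rmorphism _ -> Q})). Qed.

Lemma graded_piD p q : graded_pi (p + q) = graded_pi p + graded_pi q.
Proof. exact: (rmorphD (\pi_Q : {rmorphism _ -> Q})). Qed.

Lemma graded_piN p : graded_pi (- p) = - graded_pi p.
Proof. exact: (rmorphN (\pi_Q : {rmorphism _ -> Q})). Qed.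

Lemma graded_pi_eq p q : (graded_pi p = graded_pi q) <-> (p - q \in @rees_ideal A F).
Proof. by rewrite Quotient.idealrBE; split=> [/eqP|/eqP]. Qed.
End GradedPi.

Section GradedValues.
Variables (gT : finGroupType) (n : nat).
Local Open Scope ring_scope.
Local Notation Fil := (center_filtration gT n).
Local Notation Gr := (graded_center gT n).
Implicit Types (x y z : wreath gT n) (p q : rees_ring Fil) (a b : Gr).

(** The leading coefficient at x: the value at x of the component of degree
wr_deg x. *)
Definition rees_val x p : int := val ((val p)`_(wr_deg x)) x.

Lemma rees_coef_gt p k x : (k < wr_deg x)%N -> val ((val p)`_k) x = 0.
Proof.
move=> kx; have /asboolP/(_ k)/center_filP H := valP p.
by apply/eqP; apply: contraTT kx => /H; rewrite -leqNgt.
Qed.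

Lemma rees_idealE p : (p \in @rees_ideal _ Fil) <-> forall x, rees_val x p = 0.
Proof.
split=> [/asboolP H x|H].
  rewrite /rees_val; have := H (wr_deg x); case E: (wr_deg x) => [|k] /=.
    by move=> /eqP ->; rewrite ffunE.
  move/center_filP/(_ x) => h; apply/eqP; apply: contraT => /h; by rewrite E ltnn.
apply/asboolP => k; have H0 x : (k <= wr_deg x)%N -> val ((val p)`_k) x = 0.
  by rewrite leq_eqVlt => /orP[/eqP ->|/rees_coef_gt //]; apply: H.
case: k H0 => [|k] H0 /=; first by apply/eqP/val_inj/ffunP => x; rewrite H0 // ffunE.
by apply/center_filP => x; rewrite leqNgt; apply: contraNN => /H0 ->.
Qed.

Lemma rees_valB x p q : rees_val x (p - q) = rees_val x p - rees_val x q.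
Proof. by rewrite /rees_val /= coefB /= !ffunE. Qed.

Lemma wr_deg_eq0 x : (wr_deg x == 0)%N = (x == 1%g).
Proof.
apply/eqP/eqP => [x0|->]; last exact: wr_deg1.
by have [[|//]] := reduced_word x; rewrite x0 // /word_prod big_nil => _ <-.
Qed.

Lemma rees_val1 x : rees_val x 1 = (x == 1%g)%:R.
Proof.
rewrite /rees_val /= coef1 wr_deg_eq0; case: eqP => [->|_] /=; last by rewrite ffunE.
by rewrite ffunE eqxx.
Qed.

Lemma rees_valM z p q : rees_val z (p * q) =
  \sum_(x | (wr_deg x + wr_deg (x^-1 * z)%g == wr_deg z)%N)
     rees_val x p * rees_val (x^-1 * z)%g q.
Proof.
rewrite /rees_val /= coefM; set d := wr_deg z.
have -> : val (\sum_(j < d.+1) (val p)`_j * (val q)`_(d - j)) z =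
    \sum_(j < d.+1) \sum_x val ((val p)`_j) x * val ((val q)`_(d - j)) (x^-1 * z)%g.
  elim/big_rec2: _ => [|j f g _ <-]; first by rewrite /= ffunE.
  by rewrite /= ffunE group_ringM.
rewrite exchange_big [RHS]big_mkcond; apply: eq_bigr => x _ /=.
have dz : (d <= wr_deg x + wr_deg (x^-1 * z)%g)%N by rewrite /d -{1}(mulKVg x z) wr_degM.
have T (j : 'I_d.+1) : (wr_deg x != j) || (d != wr_deg x + wr_deg (x^-1 * z)%g)%N ->
    val ((val p)`_j) x * val ((val q)`_(d - j)) (x^-1 * z)%g = 0.
  move=> h; have [jx|xj] := ltnP j (wr_deg x); first by rewrite rees_coef_gt ?mul0r.
  rewrite [X in _ * X]rees_coef_gt ?mulr0 //.
  by have := ltn_ord j; case/orP: h => h; lia.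
case: eqP => [E|/eqP E]; last first.
  by rewrite big1 // => j _; apply: T; apply/orP; right; rewrite eq_sym.
have xd : (wr_deg x < d.+1)%N by rewrite ltnS -E leq_addr.
have dx : (d - wr_deg x)%N = wr_deg (x^-1 * z)%g by rewrite -E addKn.
rewrite (bigD1 (Ordinal xd)) //= dx big1 ?addr0 // => j jx.
by rewrite T //; apply/orP; left; rewrite eq_sym.
Qed.

Definition graded_val x a : int := rees_val x (generic_quotient.repr a).

Lemma graded_valE x p : graded_val x (graded_pi p) = rees_val x p.
Proof.
have /graded_pi_eq/rees_idealE/(_ x) :
    graded_pi (generic_quotient.repr (graded_pi p)) = graded_pi p.
  by rewrite /graded_pi reprK.
by rewrite rees_valB => /eqP; rewrite subr_eq0 => /eqP.
Qed.

Fact graded_val_additive x : zmod_morphism (graded_val x).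
Proof.
move=> a b; have [p ->] := graded_piP a; have [q ->] := graded_piP b.
by rewrite -graded_piN -graded_piD !graded_valE rees_valB.
Qed.

HB.instance Definition _ x := GRing.isZmodMorphism.Build Gr int
  (graded_val x) (graded_val_additive x).

Lemma graded_val_inj a b : (forall x, graded_val x a = graded_val x b) -> a = b.
Proof.
have [p ->] := graded_piP a; have [q ->] := graded_piP b => H.
by apply/graded_pi_eq/rees_idealE => x; rewrite rees_valB -!graded_valE H subrr.
Qed.

Lemma graded_val1 x : graded_val x 1 = (x == 1%g)%:R.
Proof. by rewrite -graded_pi1 graded_valE rees_val1. Qed.

Lemma graded_valM z a b : graded_val z (a * b) =
  \sum_(x | (wr_deg x + wr_deg (x^-1 * z)%g == wr_deg z)%N)
     graded_val x a * graded_val (x^-1 * z)%g b.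
Proof.
have [p ->] := graded_piP a; have [q ->] := graded_piP b.
rewrite -graded_piM graded_valE rees_valM.
by apply: eq_bigr => x _; rewrite !graded_valE.
Qed.

Lemma graded_val_class x y a :
  modified_type x = modified_type y -> graded_val x a = graded_val y a.
Proof.
move=> E; have [p ->] := graded_piP a; rewrite !graded_valE /rees_val /wr_deg -E.
by have [z ->] := wr_conj E; rewrite central_conj //; apply: valP.
Qed.

(** The sum of all the elements with the same modified type as x. *)
Definition class_ind x : group_ring int (wreath gT n) :=
  [ffun y => (modified_type y == modified_type x)%:R].

Lemma class_indE x y : class_ind x y = (modified_type y == modified_type x)%:R.
Proof. by rewrite ffunE. Qed.

Lemma class_ind_central x : class_ind x \in @central (group_ring int (wreath gT n)).
Proof.
apply/asboolP => f; apply/ffunP => y; rewrite !group_ringM.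
rewrite (reindex_inj (inj_comp (mulgI y) invg_inj)) /=; apply: eq_bigr => z _.
have -> : ((y * z^-1)^-1 * y = z)%g by rewrite invMg invgK mulgKV.
rewrite !class_indE.
have -> : modified_type (z^-1 * y)%g = modified_type (y * z^-1)%g.
  by rewrite -(modified_type_conj z^-1%g (y * z^-1)%g) invgK !mulgA mulgKV.
exact: mulrC.
Qed.

Definition class_elt x : center (group_ring int (wreath gT n)) :=
  Sub (class_ind x) (class_ind_central x).

Fact class_rees_proof x : ((class_elt x)%:P * 'X^(wr_deg x)) \in @rees _ Fil.
Proof.
apply/asboolP => k; rewrite coefCM coefXn; case: eqP => [->|_].
  rewrite mulr1; apply/center_filP => y /=; rewrite class_indE.
  case: (modified_type y =P _) => // E _.
  by rewrite /wr_deg E.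
by rewrite mulr0; have [] := center_fil_zmod gT n k.
Qed.

Definition class_rees x : rees_ring Fil :=
  Sub ((class_elt x)%:P * 'X^(wr_deg x)) (class_rees_proof x).

(** The corresponding homogeneous element of degree wr_deg x of the graded ring. *)
Definition class_graded x : Gr := graded_pi (class_rees x).

Lemma graded_val_class_graded y x :
  graded_val y (class_graded x) = (modified_type y == modified_type x)%:R.
Proof.
rewrite graded_valE /rees_val /= coefCM coefXn; case: eqP => [_|dyx].
  by rewrite mulr1 class_indE.
by rewrite mulr0 ffunE; case: (modified_type y =P _) => // E; case: dyx; rewrite /wr_deg E.
Qed.

(** A representative of the elements with the same modified type as x. *)
Definition type_rep x := odflt x [pick y | modified_type y == modified_type x].

Lemma type_repE x : modified_type (type_rep x) = modified_type x.
Proof. by rewrite /type_rep; case: pickP => [y /eqP|]. Qed.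

Lemma eq_type_rep x y : modified_type x = modified_type y -> type_rep x = type_rep y.
Proof. by rewrite /type_rep => ->; case: pickP => // /(_ y); rewrite eqxx. Qed.

Definition type_reps := [set x | type_rep x == x].

Lemma sum_type_reps (V : nmodType) (f : wreath gT n -> V) y :
  \sum_(x in type_reps | modified_type y == modified_type x) f x = f (type_rep y).
Proof.
rewrite (big_pred1 (type_rep y)) // => x; rewrite !inE; apply/andP/eqP => [[/eqP xx /eqP E]|->].
  by rewrite -xx; apply: eq_type_rep.
by rewrite type_repE eqxx (eq_type_rep (type_repE y)) eqxx.
Qed.

(** The elements class_graded x, for x ranging over the representatives of the types,
span the graded ring over int. *)
Lemma graded_decomp a : a = \sum_(x in type_reps) class_graded x *~ graded_val x a.
Proof.
apply: graded_val_inj => y; rewrite raddf_sum /=.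
transitivity (\sum_(x in type_reps | modified_type y == modified_type x) graded_val x a).
  by rewrite sum_type_reps; apply: graded_val_class; rewrite type_repE.
rewrite big_mkcondr; apply: eq_bigr => x _.
by rewrite raddfMz /= graded_val_class_graded; case: eqP => _; rewrite ?mul0rz // intz.
Qed.

End GradedValues.

(** * The tensor product as an algebra of class functions *)

Section TensorElim.
Variables C A : pzRingType.
Local Open Scope ring_scope.
Local Open Scope quotient_scope.

Definition pure_tensor (c : C) (a : A) : tensor C A := \pi [:: (c, a)].

Lemma pi_tensorE (s : seq (C * A)) : \pi_(tensor C A) s = \sum_(p <- s) pure_tensor p.1 p.2.
Proof.
elim: s => [|[c a] s IH]; first by rewrite big_nil.
by rewrite big_cons -IH -[in LHS](cat1s (c, a) s) pi_tensor_add.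
Qed.

Lemma pure_tensor_biadditive : biadditive pure_tensor.
Proof.
split=> [c c' a|c a a']; rewrite /pure_tensor -[RHS]pi_tensor_add;
  apply/eqP/tensor_eqP => V f [fl fr]; rewrite !big_cons big_nil /= ?addr0 //.
Qed.

Lemma pure_tensorM c c' a a' :
  pure_tensor c a * pure_tensor c' a' = pure_tensor (c * c') (a * a').
Proof. by rewrite /pure_tensor -[LHS]pi_tensor_mul. Qed.

Lemma tensorP (t : tensor C A) :
  exists s : seq (C * A), t = \sum_(p <- s) pure_tensor p.1 p.2.
Proof. by exists (generic_quotient.repr t); rewrite -pi_tensorE reprK. Qed.

Section Lift.
Variables (V : zmodType) (f : C -> A -> V).
Hypothesis bf : biadditive f.

(** The additive map on the tensor product that a biadditive map induces. *)
Definition tlift (t : tensor C A) : V := \sum_(p <- generic_quotient.repr t) f p.1 p.2.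

Lemma tlift_sum s : tlift (\sum_(p <- s) pure_tensor p.1 p.2) = \sum_(p <- s) f p.1 p.2.
Proof. by rewrite -pi_tensorE /tlift sum_repr. Qed.

Lemma tlift_pure c a : tlift (pure_tensor c a) = f c a.
Proof. by rewrite /tlift sum_repr // big_seq1. Qed.

Lemma tliftD t u : tlift (t + u) = tlift t + tlift u.
Proof.
have [s ->] := tensorP t; have [s' ->] := tensorP u.
by rewrite -big_cat !tlift_sum big_cat.
Qed.

Lemma tlift_big (I : Type) (r : seq I) (P : pred I) (F : I -> tensor C A) :
  tlift (\sum_(i <- r | P i) F i) = \sum_(i <- r | P i) tlift (F i).
Proof.
elim/big_rec2: _ => [|i t v _ <-]; last exact: tliftD.
by have := tlift_sum [::]; rewrite !big_nil.
Qed.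
End Lift.

Lemma pure_tensorZ c a (m : int) : pure_tensor c (a *~ m) = pure_tensor (c *~ m) a.
Proof.
have [pl pr] := pure_tensor_biadditive.
have p0 c' : pure_tensor c' 0 = 0.
  by apply: (addrI (pure_tensor c' 0)); rewrite -pr !addr0.
have p0l a' : pure_tensor 0 a' = 0.
  by apply: (addrI (pure_tensor 0 a')); rewrite -pl !addr0.
have pN c' a' : pure_tensor c' (- a') = pure_tensor (- c') a'.
  by apply: (addIr (pure_tensor c' a')); rewrite -pl -pr !addNr p0 p0l.
have pM c' (k : nat) : pure_tensor c' (a *+ k) = pure_tensor (c' *+ k) a.
  by elim: k => [|k IH]; rewrite ?mulr0n ?p0 ?p0l // !mulrS pl pr IH.
case: m => k; first by rewrite -!pmulrn pM.
by rewrite NegzE !mulrNz pN -!pmulrn pM mulNrn.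
Qed.

End TensorElim.

Section TensorValues.
Variables (gT : finGroupType) (n : nat) (K : comNzRingType).
Local Open Scope ring_scope.
Local Notation Gr := (graded_center gT n).
Local Notation T := (tensor K Gr).
Implicit Types (x y z : wreath gT n) (t u : T) (c : K) (a : Gr).

Definition pure_val x c a : K := c * (graded_val x a)%:~R.

Lemma pure_val_biadditive x : biadditive (pure_val x).
Proof.
split=> [c c' a|c a a']; rewrite /pure_val; first by rewrite mulrDl.
by rewrite raddfD intrD mulrDr.
Qed.

(** The extension of scalars of graded_val x. *)
Definition tensor_val t x : K := tlift (pure_val x) t.

Lemma tensor_valD t u x : tensor_val (t + u) x = tensor_val t x + tensor_val u x.
Proof. apply: tliftD; exact: pure_val_biadditive. Qed.

Lemma tensor_val_sum (I : Type) (r : seq I) (P : pred I) (F : I -> T) x :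
  tensor_val (\sum_(i <- r | P i) F i) x = \sum_(i <- r | P i) tensor_val (F i) x.
Proof. apply: tlift_big; exact: pure_val_biadditive. Qed.

Lemma tensor_val_pure c a x : tensor_val (pure_tensor c a) x = c * (graded_val x a)%:~R.
Proof. apply: tlift_pure; exact: pure_val_biadditive. Qed.

Lemma tensor_val1 x : tensor_val 1 x = (x == 1%g)%:R.
Proof.
rewrite -[1]/(pure_tensor 1 1 : T) tensor_val_pure graded_val1 mul1r.
by case: eqP.
Qed.

Lemma tensor_valM t u z : tensor_val (t * u) z =
  \sum_(x | (wr_deg x + wr_deg (x^-1 * z)%g == wr_deg z)%N)
     tensor_val t x * tensor_val u (x^-1 * z)%g.
Proof.
have [s ->] := tensorP t; have [s' ->] := tensorP u.
rewrite mulr_suml tensor_val_sum.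
under eq_bigr do rewrite mulr_sumr tensor_val_sum.
under [RHS]eq_bigr do rewrite !tensor_val_sum mulr_suml.
rewrite [RHS]exchange_big; apply: eq_bigr => p _.
under [RHS]eq_bigr do rewrite mulr_sumr.
rewrite [RHS]exchange_big; apply: eq_bigr => q _ /=.
rewrite pure_tensorM tensor_val_pure graded_valM rmorph_sum mulr_sumr; apply: eq_bigr => x _.
by rewrite !tensor_val_pure rmorphM /= mulrACA.
Qed.

Lemma tensor_val_class t x y :
  modified_type x = modified_type y -> tensor_val t x = tensor_val t y.
Proof.
move=> E; have [s ->] := tensorP t; rewrite !tensor_val_sum; apply: eq_bigr => p _.
by rewrite !tensor_val_pure (graded_val_class _ E).
Qed.

Lemma tensor_decomp t : t = \sum_(x in type_reps gT n) pure_tensor (tensor_val t x) (class_graded x).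
Proof.
have [pl pr] := @pure_tensor_biadditive K Gr.
have p0l a : pure_tensor (0 : K) a = 0 by apply: (addrI (pure_tensor 0 a)); rewrite -pl !addr0.
have p0r c : pure_tensor c (0 : Gr) = 0 by apply: (addrI (pure_tensor c 0)); rewrite -pr !addr0.
have [s ->] := tensorP t.
under [RHS]eq_bigr => x _.
  rewrite tensor_val_sum.
  rewrite (big_morph (fun c => pure_tensor c (class_graded x)) (id1 := 0) (op1 := +%R)) //.
over.
rewrite exchange_big; apply: eq_bigr => p _ /=.
rewrite {1}(graded_decomp p.2) (big_morph (pure_tensor p.1) (id1 := 0) (op1 := +%R)) //.
by apply: eq_bigr => x _; rewrite pure_tensorZ tensor_val_pure mulrzr.
Qed.

Lemma tensor_val_inj t u : tensor_val t =1 tensor_val u -> t = u.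
Proof.
by move=> E; rewrite (tensor_decomp t) (tensor_decomp u); apply: eq_bigr => x _; rewrite E.
Qed.

(** The element of the tensor product with given values on the representatives. *)
Definition tensor_of (f : wreath gT n -> K) : T :=
  \sum_(x in type_reps gT n) pure_tensor (f x) (class_graded x).

Lemma tensor_ofE f y : (forall x y, modified_type x = modified_type y -> f x = f y) ->
  tensor_val (tensor_of f) y = f y.
Proof.
move=> cf; rewrite tensor_val_sum -(cf _ _ (type_repE y)) -sum_type_reps [RHS]big_mkcondr.
apply: eq_bigr => x _; rewrite tensor_val_pure graded_val_class_graded.
by case: eqP => _; rewrite ?mulr1 ?mulr0.
Qed.

End TensorValues.

(** * Matching the conjugacy classes *)

(** Two finite sets with involutions, of the same size and with the same number of
fixed points, are equivariantly in bijection: orbits are removed one by one. *)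
Lemma involution_matching (S T : finType) (i : S -> S) (j : T -> T) (t0 : T)
    (A : {set S}) (B : {set T}) :
  involutive i -> involutive j ->
  {in A, forall a, i a \in A} -> {in B, forall b, j b \in B} ->
  #|A| = #|B| -> #|[set a in A | i a == a]| = #|[set b in B | j b == b]| ->
  exists f : S -> T, {in A &, injective f} /\
    {in A, forall a, f a \in B /\ f (i a) = j (f a)}.
Proof.
move=> iK jK; elim: {A}_.+1 {-2}A B (ltnSn #|A|) => // m IH A B Am iA jB AB FAB.
have [->|[a aA]] := set_0Vmem A; first by exists (fun=> t0); split=> x; rewrite inE.
have [b bB bfix] : exists2 b, b \in B & (j b == b) = (i a == a).
  have [ia|ia] := boolP (i a == a).
    have : 0 < #|[set b in B | j b == b]|.
      by rewrite -FAB; apply/card_gt0P; exists a; rewrite inE aA.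
    by case/card_gt0P => b; rewrite inE => /andP[bB jb]; exists b.
  have : 0 < #|[set b in B | j b != b]|.
    have E (U : finType) (k : U -> U) (X : {set U}) :
        #|X| = #|[set x in X | k x == x]| + #|[set x in X | k x != x]|.
      rewrite -(cardsID [set x | k x == x] X); congr (_ + _); apply: eq_card => x; rewrite !inE //.
      by rewrite andbC.
    have := AB; rewrite (E _ i A) (E _ j B) FAB => /addnI <-.
    by apply/card_gt0P; exists a; rewrite inE aA.
  by case/card_gt0P => b; rewrite inE => /andP[bB /negPf jb]; exists b.
pose A' := A :\: [set a; i a]; pose B' := B :\: [set b; j b].
have stab (U : finType) (k : U -> U) (X : {set U}) x : involutive k ->
    {in X, forall y, k y \in X} -> {in X :\: [set x; k x], forall y, k y \in X :\: [set x; k x]}.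
  move=> kK kX y; rewrite !inE !negb_or => /andP[/andP[yx ykx] yX]; rewrite kX // andbT.
  by rewrite -(inj_eq (inv_inj kK)) kK ykx (inj_eq (inv_inj kK)) yx.
have AsubE : [set a; i a] \subset A.
  by apply/subsetP => x; rewrite !inE => /orP[] /eqP ->; rewrite ?iA.
have BsubE : [set b; j b] \subset B.
  by apply/subsetP => x; rewrite !inE => /orP[] /eqP ->; rewrite ?jB.
have c2 : #|[set a; i a]| = #|[set b; j b]| by rewrite !cards2 (eq_sym a) (eq_sym b) bfix.
have AB' : #|A'| = #|B'| by rewrite !cardsDS // AB c2.
have FAB' : #|[set x in A' | i x == x]| = #|[set x in B' | j x == x]|.
  have E (U : finType) (k : U -> U) (X : {set U}) x : involutive k -> x \in X ->
     #|[set y in X | k y == y]| = (k x == x) + #|[set y in X :\: [set x; k x] | k y == y]|.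
    move=> kK xX; rewrite (cardsD1 x) inE xX; congr (_ + _); apply: eq_card => y; rewrite !inE.
    have [->|yx] //= := eqVneq y x; have [yk|ykx] //= := eqVneq y (k x).
    by apply/negP => /andP[_]; rewrite yk kK -yk eq_sym (negPf yx).
  by have := FAB; rewrite (E _ i A a) // (E _ j B b) // bfix => /addnI.
have Am' : #|A'| < m.
  rewrite -ltnS (leq_ltn_trans _ Am) // proper_card //.
  apply/properP; split; first exact: subsetDl.
  by exists a; rewrite // !inE eqxx.
have [f [finj fP]] := IH A' B' Am' (stab _ i A a iK iA) (stab _ j B b jK jB) AB' FAB'.
pose g x := if x == a then b else if x == i a then j b else f x.
have inA' x : x \in A -> x != a -> x != i a -> x \in A' by rewrite !inE => -> /negPf -> /negPf ->.
have fB x : x \in A -> x != a -> x != i a -> [/\ f x \in B, f x != b & f x != j b].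
  move=> xA xa xia; have [] := fP x (inA' x xA xa xia).
  by rewrite !inE negb_or => /andP[/andP[-> ->] ->].
exists g; split=> [x y xA yA|x xA]; rewrite /g.
  have jb : i a != a -> j b != b by rewrite bfix.
  case: (eqVneq x a) => [->|xa]; case: (eqVneq y a) => [->|ya] //.
  - case: (eqVneq y (i a)) => [yia|yia]; last by case: (fB y) => // _ /eqP h _ /esym.
    by move=> e; have := jb; rewrite -yia ya => /(_ isT) /eqP[].
  - case: (eqVneq x (i a)) => [xia|xia]; last by case: (fB x) => // _ /eqP h _.
    by move=> e; have := jb; rewrite -xia xa => /(_ isT) /eqP[].
  case: (eqVneq x (i a)) => [->|xia]; case: (eqVneq y (i a)) => [->|yia] //.
  - by case: (fB y) => // _ _ /eqP h /esym.
  - by case: (fB x) => // _ _ /eqP h.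
  by apply: finj; apply: inA'.
case: (eqVneq x a) => [->|xa].
  split=> //; case: eqP => [ia|_]; last by rewrite eqxx.
  by move: bfix; rewrite ia eqxx => /eqP.
case: (eqVneq x (i a)) => [->|xia]; first by rewrite iK eqxx jK jB.
have [fxB _ _] := fB x xA xa xia; split=> //.
have [_ ->] := fP x (inA' x xA xa xia).
by rewrite -(inj_eq (inv_inj iK)) iK (negPf xia) (inj_eq (inv_inj iK)) (negPf xa).
Qed.

Section ClassInverse.
Variable gT : finGroupType.
Implicit Types (c : conj_class gT) (g : gT).
Local Open Scope group_scope.

(** The class of the inverses of the elements of c. *)
Definition class_inverse c : conj_class gT := class_of (repr (val c))^-1.

Lemma val_class_inverse c : val (class_inverse c) = (val c)^-1.
Proof.
rewrite -class_ofV; congr (val _)^-1; apply/eqP; rewrite -class_ofP.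
by have /card_gt0P[g] := conj_class_gt0 c; apply: mem_repr.
Qed.

Lemma class_inverse_of g : class_inverse (class_of g) = class_of g^-1.
Proof. by apply/val_inj; rewrite val_class_inverse class_ofV. Qed.

Lemma class_inverseK : involutive class_inverse.
Proof. by move=> c; apply/val_inj; rewrite !val_class_inverse invgK. Qed.

Lemma real_classE c : real_class c = (c != class_of 1) && (class_inverse c == c).
Proof.
by rewrite /real_class val_c1; congr (_ && _); rewrite -[RHS]val_eqE val_class_inverse.
Qed.

End ClassInverse.

Lemma class_bijection (gT hT : finGroupType) :
  #|{: conj_class gT}| = #|{: conj_class hT}| ->
  #|[set c : conj_class gT | real_class c]| = #|[set c : conj_class hT | real_class c]| ->
  exists beta : conj_class gT -> conj_class hT, [/\ bijective beta,
    beta (class_of 1%g) = class_of 1%g &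
    forall g h, beta (class_of g) = class_of h -> beta (class_of g^-1%g) = class_of h^-1%g].
Proof.
move=> cc cr; set c1 := class_of (1%g : gT); set d1 := class_of (1%g : hT).
have inv1 (T : finGroupType) : class_inverse (class_of (1%g : T)) = class_of 1%g.
  by rewrite class_inverse_of invg1.
have stab (T : finGroupType) : {in [set~ class_of (1%g : T)],
    forall c, class_inverse c \in [set~ class_of (1%g : T)]}.
  by move=> c; rewrite !inE -{2}inv1 (inj_eq (inv_inj (@class_inverseK T))).
have fixE (T : finGroupType) : [set c in [set~ class_of (1%g : T)] | class_inverse c == c]
    = [set c | real_class c] by apply/setP => c; rewrite !inE real_classE.
have [||f [finj fP]] := @involution_matching _ _ _ _ d1 [set~ c1] [set~ d1]
  (@class_inverseK gT) (@class_inverseK hT) (stab gT) (stab hT).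
- by rewrite !cardsC1 cc.
- by rewrite !fixE.
pose beta c := if c == c1 then d1 else f c.
have fd c : c != c1 -> f c != d1 by move=> h; have [] := fP c; rewrite !inE.
have beta_inj : injective beta.
  move=> c d; rewrite /beta; case: (eqVneq c c1) => [->|cc1]; case: (eqVneq d c1) => [->|dc1] //.
  - by move=> h; have := fd d dc1; rewrite -h eqxx.
  - by move=> h; have := fd c cc1; rewrite h eqxx.
  by apply: finj; rewrite !inE.
exists beta; split; first by apply: inj_card_bij beta_inj _; rewrite cc.
  by rewrite /beta eqxx.
move=> g h; rewrite /beta -!class_inverse_of => gh.
case: (eqVneq (class_of g) c1) gh => [-> <-|gc <-]; first by rewrite inv1 eqxx inv1.
rewrite -(inj_eq (inv_inj (@class_inverseK gT))) class_inverseK inv1 (negPf gc).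
by have [] := fP (class_of g); rewrite !inE.
Qed.

(** * The isomorphism *)

Section Transport.
Variables (gT hT : finGroupType) (beta : conj_class gT -> conj_class hT).
Hypothesis beta_bij : bijective beta.
Hypothesis beta1 : beta (class_of 1%g) = class_of 1%g.
Hypothesis betaV : forall g h, beta (class_of g) = class_of h ->
  beta (class_of g^-1%g) = class_of h^-1%g.
Variables (n : nat) (K : numClosedFieldType).
Local Open Scope ring_scope.
Local Notation TG := (tensor K (graded_center gT n)).
Local Notation TH := (tensor K (graded_center hT n)).
Implicit Types (t u : TG) (s : TH) (x : wreath gT n) (y : wreath hT n).

(** The element whose values correspond to those of t. *)
Definition transport t : TH :=
  tensor_of (fun y => total_weight K y * type_val (tensor_val t) (pull beta (modified_type y))).

Lemma class_fun_tensor (T : finGroupType) (t : tensor K (graded_center T n)) :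
  class_fun (tensor_val t).
Proof. by move=> x y; apply: tensor_val_class. Qed.

Lemma tensor_val_transport t y : tensor_val (transport t) y =
  total_weight K y * type_val (tensor_val t) (pull beta (modified_type y)).
Proof. by rewrite tensor_ofE // => x z E; rewrite (class_fun_weight _ E) E. Qed.

Lemma corresponds_transport t : corresponds beta (tensor_val t) (tensor_val (transport t)).
Proof.
move=> x y E; rewrite tensor_val_transport -E type_valE; last exact: class_fun_tensor.
by rewrite [X in _ = X / _]mulrC mulfK ?total_weight_neq0.
Qed.

Lemma corresponds_transport_eq t s :
  corresponds beta (tensor_val t) (tensor_val s) -> s = transport t.
Proof.
move=> ts; apply: tensor_val_inj => y; have [x E] := realization beta_bij beta1 y.
apply: (mulIf (invr_neq0 (total_weight_neq0 K y))).
by rewrite -(ts x y E) -(corresponds_transport t E).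
Qed.

Fact transport_additive : zmod_morphism transport.
Proof.
have D t u : transport (t + u) = transport t + transport u.
  symmetry; apply: corresponds_transport_eq => x y E.
  by rewrite !tensor_valD !mulrDl !(corresponds_transport _ E).
by move=> t u; apply: (addIr (transport u)); rewrite -D !subrK.
Qed.

Lemma total_weight1 (T : finGroupType) : total_weight K (1%g : wreath T n) = 1.
Proof.
have := sum_word_weight0 (fun x : wreath T n => (x == 1%g)%:R : K).
rewrite eqxx (bigD1 1%g) //= eqxx mulr1 big1 ?addr0 => [|x /negPf ->]; last by rewrite mulr0.
by rewrite /total_weight wr_deg1.
Qed.

Fact transport_multiplicative : monoid_morphism transport.
Proof.
split=> [|t u].
  symmetry; apply: corresponds_transport_eq => x y E; rewrite !tensor_val1.
  have dE : wr_deg x = wr_deg y by rewrite /wr_deg E pf_norm_pull.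
  rewrite -!wr_deg_eq0 dE wr_deg_eq0; case: eqP => [y1|_]; last by rewrite !mul0r.
  have /eqP x1 : x == 1%g by rewrite -wr_deg_eq0 dE y1 wr_deg1.
  by rewrite x1 y1 !total_weight1.
symmetry; apply: corresponds_transport_eq => x y E.
have /(_ x y E) := graded_conv_corresponds beta_bij beta1 betaV
  (class_fun_tensor t) (class_fun_tensor u)
  (class_fun_tensor (transport t)) (class_fun_tensor (transport u))
  (corresponds_transport t) (corresponds_transport u).
by rewrite /graded_conv -!tensor_valM.
Qed.

HB.instance Definition _ := GRing.isZmodMorphism.Build TG TH transport transport_additive.
HB.instance Definition _ := GRing.isMonoidMorphism.Build TG TH transport transport_multiplicative.

Definition transport_rmorphism : {rmorphism TG -> TH} := transport.

End Transport.

Lemma transportK (gT hT : finGroupType) (beta : conj_class gT -> conj_class hT)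
    (gamma : conj_class hT -> conj_class gT) n (K : numClosedFieldType) :
  cancel beta gamma -> cancel gamma beta -> beta (class_of 1%g) = class_of 1%g ->
  cancel (transport beta (n := n) (K := K)) (transport gamma (n := n) (K := K)).
Proof.
move=> betaK gammaK beta1 t.
have gamma_bij : bijective gamma by exists beta.
have gamma1 : gamma (class_of 1%g) = class_of 1%g by rewrite -beta1 betaK.
symmetry; apply: (corresponds_transport_eq gamma_bij gamma1) => y x E.
symmetry; apply: corresponds_transport; rewrite E.
by apply/ffunP => c; rewrite !ffunE betaK.
Qed.

Theorem theorem3p17 (R : realType) (gT hT : finGroupType)
    (card_classes : #|{: conj_class gT}| = #|{: conj_class hT}|)
    (card_real : #|[set c : conj_class gT | real_class c]|
                 = #|[set c : conj_class hT | real_class c]|)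
    (n : nat) (n_ge1 : 1 <= n) :
  exists f : {rmorphism tensor R[i] (graded_center gT n)
                     -> tensor R[i] (graded_center hT n)},
    bijective f.
Proof.
have [beta [beta_bij beta1 betaV]] := class_bijection card_classes card_real.
exists (transport_rmorphism beta_bij beta1 betaV n R[i]).
have [gamma betaK gammaK] := beta_bij.
exists (transport gamma (n := n) (K := R[i])); first exact: transportK.
by apply: transportK => //; rewrite -beta1 betaK.
Qed.
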